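(* The transition kernel $P$ of the one-point Markov chain $\{\Phi_{\underline{\tau}}^m\}_{m\ge 0}$ on $\mathbb{T}^3$ is uniformly geometrically ergodic; that is, $P$ admits a unique stationary probability measure $\mu$ on $\mathbb{T}^3$, and there exist constants $C>0$ and $\gamma\in(0,1)$ such that $$\left|P^m g(x)-\int g\,d\mu\right|\le C\,\|g\|_{\infty}\,\gamma^m$$ for all $m\in\mathbb{N}$, all $x\in\mathbb{T}^3$ and all bounded measurable $g:\mathbb{T}^3\to\mathbb{R}$, where $\|g\|_\infty=\sup_{x}|g(x)|$.
   Context: Let $\mathbb{S}^1=\mathbb{R}/(2\pi\mathbb{Z})$ and $\mathbb{T}^3=\mathbb{R}^3/(2\pi\mathbb{Z})^3$. Let $f_1,f_2,f_3\in C^\omega(\mathbb{S}^1,\mathbb{R})$ be non-constant real-analytic functions. For $g:\mathbb{S}^1\to\mathbb{R}$ write $C_g=\{x\in\mathbb{S}^1: g(x)=0\}$. Standing assumption (H1): for $i=1,2,3$, $C_{f_i}\cap C_{f_i'}=\emptyset$ and $C_{f_i'}\cap C_{f_i''}=\emptyset$. For $x=(x_1,x_2,x_3)\in\mathbb{T}^3$ define the vector fields $X_1(x)=(f_1(x_3),f_1'(x_3),0)$, $X_2(x)=(0,f_2(x_1),f_2'(x_1))$, $X_3(x)=(f_3'(x_2),0,f_3(x_2))$, and let $\varphi^{(i)}_t$ be the flow of $\dot x=X_i(x)$. Fix $h>0$ and let $\tau_1,\tau_2,\dots$ be i.i.d. exponential random variables with mean $h$, $\underline{\tau}=(\tau_1,\tau_2,\dots)$.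 Define $\Phi^0_{\underline{\tau}}=I$ (identity) and $\Phi^m_{\underline{\tau}}=\varphi^{(3)}_{\tau_{3m}}\circ\varphi^{(2)}_{\tau_{3m-1}}\circ\varphi^{(1)}_{\tau_{3m-2}}(\Phi^{m-1}_{\underline{\tau}})$ for $m\ge1$; write $\Phi_{\underline{\tau}}=\Phi^1_{\underline{\tau}}$. The transition kernel is $P(x,D)=\mathbb{P}(\Phi_{\underline{\tau}}(x)\in D)$ for Borel $D\subset\mathbb{T}^3$, acting on functions by $Pg(x)=\mathbb{E}g(\Phi_{\underline{\tau}}(x))$ and on measures by $P^*\mu(D)=\int P(x,D)\,\mu(dx)$. A probability measure $\mu$ is stationary if $P^*\mu=\mu$. *)

(* Defs.v *)
From HB Require Import structures.
From mathcomp Require Import all_boot all_order all_algebra finmap.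
From mathcomp Require Import all_classical all_reals all_analysis.

Set Implicit Arguments.
Unset Strict Implicit.
Unset Printing Implicit Defensive.

Import Order.TTheory GRing.Theory Num.Theory.
Import numFieldNormedType.Exports.

Local Open Scope classical_set_scope.
Local Open Scope ring_scope.
Local Open Scope quotient_scope.

Section Circle.
Context {R : realType}.

Definition circle_rel (x y : R) : bool :=
  `[< exists k : int, x - y = k%:~R * (2 * pi) >].

Lemma circle_rel_refl : reflexive circle_rel.
Proof. by move=> x; apply/asboolP; exists 0; rewrite subrr mul0r. Qed.

Lemma circle_rel_sym : symmetric circle_rel.
Proof.
suff H x y : circle_rel x y -> circle_rel y x.
  by move=> x y; apply/idP/idP; exact: H.
move=> /asboolP[k xy]; apply/asboolP; exists (- k).
by rewrite mulrNz mulNr -xy opprB.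
Qed.

Lemma circle_rel_trans : transitive circle_rel.
Proof.
move=> y x z /asboolP[k xy] /asboolP[l yz]; apply/asboolP; exists (k + l).
by rewrite intrD mulrDl -xy -yz addrA subrK.
Qed.

Canonical circle_equiv :=
  EquivRel circle_rel circle_rel_refl circle_rel_sym circle_rel_trans.

End Circle.

(* S^1 = R / 2 pi Z, with the quotient topology. *)
Definition circle (R : realType) := quotient_topology {eq_quot (@circle_rel R)}.

(* T^3 is identified with (S^1)^3; [borel_torus] is the same type, equipped with
   the sigma-algebra generated by the open sets of the product topology. *)
Definition torus (R : realType) : Type := (circle R * circle R * circle R)%type.

Definition borel_torus (R : realType) := g_sigma_algebraType (@open (torus R)).

Section Analysis.
Context {R : realType}.

Definition circle_proj (x : R) : circle R := \pi_(circle R) x.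

Definition torus_proj (x : R * R * R) : torus R :=
  (circle_proj x.1.1, circle_proj x.1.2, circle_proj x.2).

Definition circle_lift (f : circle R -> R) : R -> R := f \o circle_proj.

(* The lift is 2 pi-periodic, so the value below does not depend on the choice
   of the representative. *)
Definition circle_deriv (f : circle R -> R) (x : circle R) : R :=
  derive1 (circle_lift f) (repr x).

Definition real_analytic (g : R -> R) : Prop :=
  forall x0 : R, exists a : nat -> R,
    \forall x \near x0, pseries a (x - x0) n @[n --> \oo] --> g x.

Definition circle_analytic (f : circle R -> R) : Prop :=
  real_analytic (circle_lift f).

Definition nonconstant (f : circle R -> R) : Prop := exists x y, f x <> f y.

Definition zero_set (g : circle R -> R) : set (circle R) := [set x | g x = 0].

Definition H1 (f : circle R -> R) : Prop :=
  zero_set f `&` zero_set (circle_deriv f) = set0 /\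
  zero_set (circle_deriv f) `&` zero_set (circle_deriv (circle_deriv f)) = set0.

Definition X1 (f1 : circle R -> R) (x : torus R) : R * R * R :=
  let: (_, _, x3) := x in (f1 x3, circle_deriv f1 x3, 0).

Definition X2 (f2 : circle R -> R) (x : torus R) : R * R * R :=
  let: (x1, _, _) := x in (0, f2 x1, circle_deriv f2 x1).

Definition X3 (f3 : circle R -> R) (x : torus R) : R * R * R :=
  let: (_, x2, _) := x in (circle_deriv f3 x2, 0, f3 x2).

(* A curve in T^3 is differentiable with velocity v iff it lifts through the
   covering R^3 -> T^3 to a differentiable curve with velocity v. *)
Definition integral_curve (X : torus R -> R * R * R) (u : R -> torus R) : Prop :=
  exists2 c : R -> R * R * R,
    forall t : R, torus_proj (c t) = u t &
    forall t : R, is_derive t (1 : R) c (X (u t)).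

Definition is_flow (X : torus R -> R * R * R) (phi : R -> torus R -> torus R) :
    Prop :=
  forall x : torus R, phi 0 x = x /\ integral_curve X (phi ^~ x).

(* [t k] is the (k+1)-st switching time, so that the three times used between
   steps m and m+1 are t_(3m+1), t_(3m+2), t_(3m+3) in one-based numbering. *)
Fixpoint Phi (phi1 phi2 phi3 : R -> torus R -> torus R) (t : nat -> R) (m : nat)
    (x : torus R) : torus R :=
  if m is k.+1 then
    phi3 (t (3 * k + 2)%N) (phi2 (t (3 * k + 1)%N) (phi1 (t (3 * k)%N)
      (Phi phi1 phi2 phi3 t k x)))
  else x.

End Analysis.

Section Probability.
Context {d : measure_display} {Omega : measurableType d} {R : realType}.
Variable Pr : probability Omega R.

Definition mutually_independent (X : nat -> {RV Pr >-> R}) : Prop :=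
  forall (J : {fset nat}) (A : nat -> set R),
    (forall i, measurable (A i)) ->
    Pr (\bigcap_(i in [set` J]) (X i @^-1` A i)) =
    (\prod_(i <- J) Pr (X i @^-1` A i))%E.

Definition iid_exponential (h : R) (X : nat -> {RV Pr >-> R}) : Prop :=
  mutually_independent X /\
  forall i (A : set R), measurable A ->
    distribution Pr (X i) A = exponential_prob h^-1 A.

Variable F : Omega -> torus R -> torus R.

Definition transition_kernel (x : borel_torus R) (D : set (borel_torus R)) : \bar R :=
  Pr [set w | D (F w x)].

Definition transition_op (g : borel_torus R -> R) (x : borel_torus R) : R :=
  fine 'E_Pr[fun w => g (F w x)].

Definition transition_dual (mu : probability (borel_torus R) R)
    (D : set (borel_torus R)) : \bar R :=
  (\int[mu]_x transition_kernel x D)%E.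

(* Library measures are unconstrained off the sigma-algebra, so measures are
   compared on measurable sets only. *)
Definition stationary (mu : probability (borel_torus R) R) : Prop :=
  forall D, measurable D -> transition_dual mu D = mu D.

End Probability.

Definition sup_norm {R : realType} (g : borel_torus R -> R) : R :=
  sup [set `|g x| | x in setT].

(* Main.v *)
(* A Markov operator P on bounded measurable functions with P^4 u x + P^4 v y >= a c
   whenever u, v >= 0 and u + v = c contracts oscillations geometrically; the limits
   of P^n g are constants, defining a Daniell functional, hence the stationary law.

   On R^3 the i-th flow is the explicit shear flow_i, because X_i does not depend on
   the coordinate selecting its velocity. Choose z on the boundary of the zero set of
   f1', and x1, x2 critical points of f2, f3. At (x1, x2, z), (H1) makes the speeds
   f1(z), f2(x1), f3(x2) nonzero, and for x3 close to z the displacement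
   (s, t, r) |-> flow3_r (flow2_t (flow1_s x)) covers a fixed box: three
   one-dimensional changes of variables and Tonelli bound the averaged value below
   by a multiple of the integral over that box, near (x1, x2, z). Every point
   reaches this neighbourhood within three more rounds, where flows not needed are
   run for arbitrarily short times, and compactness makes the bound uniform. *)
Require Import Defs.
From HB Require Import structures.
From mathcomp Require Import all_boot all_order all_algebra finmap.
From mathcomp Require Import all_classical all_reals all_analysis.
From mathcomp Require Import measurable_realfun ring lra.

Set Implicit Arguments.
Unset Strict Implicit.
Unset Printing Implicit Defensive.

Import Order.TTheory GRing.Theory Num.Theory.
Import numFieldNormedType.Exports.

Local Open Scope classical_set_scope.
Local Open Scope ring_scope.

(** * Bounded measurable functions and functionals continuous for bounded pointwise convergence *)

Section BoundedMeasurable.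
Import HBSimple HBNNSimple.
Context {d : measure_display} {T : measurableType d} {R : realType}.
Implicit Types (g : T -> R) (L : (T -> R) -> R).

(** The hypothesis with [u + v = c] carries what a common minorizing measure would give, without
    constructing one on the torus: it suffices to bound [P^4] below by a fixed additive functional,
    here a multiple of the Lebesgue integral of the lift over a box, which sends [u + v] to [c]
    times the volume. Since only lower bounds matter, no Jacobian is computed: a continuous nearly
    affine map covers an interval, and its Lipschitz constant bounds the mass of preimages from
    below.

    The displacement has a derivative with columns [(F1, D1, 0)], [(0, F2, D2)], [(D3, 0, F3)].
    Where [D1] and [D3] vanish it is triangular with diagonal [F1], [F2], [F3], and this dictates
    the base point. The zero [z] of [D1] lies on the boundary of the zero set for a different
    reason: the neighbourhood of the base point is entered along a level of [x3] on which the slope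
    [D1 / F1] is small but nonzero, so that the orbit of [flow1] winds around the torus of
    [(x1, x2)] with closely spaced turns. *)

Definition bmeas g := measurable_fun setT g /\ exists M : R, forall y, `|g y| <= M.

Lemma bmeas_cst (a : R) : bmeas (fun=> a).
Proof. by split; [exact: measurable_cst|exists `|a|]. Qed.

Lemma bmeas_lin (a : R) g1 g2 : bmeas g1 -> bmeas g2 -> bmeas (fun x => a * g1 x + g2 x).
Proof.
move=> [m1 [M1 b1]] [m2 [M2 b2]]; split.
  by apply: measurable_funD => //; apply: measurable_funM => //; exact: measurable_cst.
exists (`|a| * M1 + M2) => y; rewrite (le_trans (ler_normD _ _))// lerD//.
by rewrite normrM ler_wpM2l.
Qed.

Lemma bmeas_indic (D : set T) : measurable D -> bmeas (\1_D : T -> R).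
Proof.
move=> mD; split; first exact: measurable_indic.
by exists 1 => y; rewrite indicE; case: (_ \in _); rewrite ?normr1 ?normr0.
Qed.

Lemma bmeas_integrable (mu : {finite_measure set T -> \bar R}) g :
  bmeas g -> mu.-integrable setT (EFin \o g).
Proof.
move=> [mg [M gM]]; apply: measurable_bounded_integrable => //.
  by rewrite ltey_eq fin_num_measure.
exists M; split; first by rewrite num_real.
by move=> x /ltW Mx y _; exact: le_trans (gM y) Mx.
Qed.

(* [bpc] stands for bounded pointwise convergence. *)
Record bpc_functional L : Prop := BpcFunctional {
  bpc_lin : forall (a : R) g1 g2, bmeas g1 -> bmeas g2 ->
    L (fun x => a * g1 x + g2 x) = a * L g1 + L g2 ;
  bpc_cvg : forall (u : nat -> T -> R) g (M : R), (forall n, bmeas (u n)) -> bmeas g ->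
    (forall n x, `|u n x| <= M) -> (forall x, u n x @[n --> \oo] --> g x) ->
    L (u n) @[n --> \oo] --> L g }.

Lemma bpc0 L : bpc_functional L -> L (fun=> 0) = 0.
Proof.
move=> HL; have := bpc_lin HL (-1) (bmeas_cst 0) (bmeas_cst 0).
have -> : (fun=> -1 * 0 + 0) = (fun=> 0) :> (T -> R).
  by apply/funext => x; rewrite mulr0 add0r.
by rewrite mulN1r addNr.
Qed.

Lemma bpc_sum L (I : eqType) (s : seq I) (a : I -> R) (f : I -> T -> R) :
  bpc_functional L -> (forall i, i \in s -> bmeas (f i)) ->
  bmeas (fun x => \sum_(i <- s) a i * f i x) /\
  L (fun x => \sum_(i <- s) a i * f i x) = \sum_(i <- s) a i * L (f i).
Proof.
move=> HL; elim: s => [|i s IH] Hs.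
  under eq_fun do rewrite big_nil.
  by split; [exact: bmeas_cst|rewrite bpc0// big_nil].
have [|IHb IHL] := IH; first by move=> j js; apply: Hs; rewrite in_cons js orbT.
have bi : bmeas (f i) by apply: Hs; rewrite mem_head.
under eq_fun do rewrite big_cons.
by split; [exact: bmeas_lin|rewrite bpc_lin// big_cons IHL].
Qed.

(** Linearity extends the equality to simple functions. A nonnegative [g] is the limit of simple
    approximations, which stay below its bound [M]; a signed [g] becomes nonnegative after adding
    [M]. *)
Lemma bpc_unique L1 L2 : bpc_functional L1 -> bpc_functional L2 ->
  (forall D, measurable D -> L1 (\1_D) = L2 (\1_D)) ->
  forall g, bmeas g -> L1 g = L2 g.
Proof.
move=> H1 H2 H12.
have Hs (f : {nnsfun T >-> R}) : bmeas f /\ L1 f = L2 f.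
  have -> : (f : T -> R) =
      fun x => \sum_(y <- fset_set (range f)) y * \1_(f @^-1` [set y]) x.
    by apply/funext => x; rewrite {1}(fimfunE f x) fsbig_finite.
  have mi i : i \in fset_set (range f) -> bmeas (\1_(f @^-1` [set i]) : T -> R).
    by move=> _; apply: bmeas_indic.
  have [b1 ->] := bpc_sum (fun i => i) H1 mi.
  have [_ ->] := bpc_sum (fun i => i) H2 mi.
  by split => //; apply: eq_bigr => i _; rewrite H12.
have Hp g : bmeas g -> (forall x, 0 <= g x) -> L1 g = L2 g.
  move=> bg g0; have [mg [M gM]] := bg.
  have mE : measurable_fun setT (EFin \o g) by exact/measurable_EFinP.
  pose u n : T -> R := nnsfun_approx measurableT mE n.
  have ug x : u n x @[n --> \oo] --> g x.
    have : EFin \o u ^~ x @ \oo --> (g x)%:E.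
      by apply: (@cvg_nnsfun_approx _ _ _ _ measurableT _ mE) => // y _; rewrite lee_fin.
    by move=> /fine_cvgP[_].
  have uM n x : `|u n x| <= M.
    rewrite ger0_norm; last by rewrite /u.
    apply: le_trans (gM x); rewrite ger0_norm// -lee_fin.
    have := @le_approx _ _ _ setT (EFin \o g) n x.
    by rewrite /u nnsfun_approxE => ->//= y _; rewrite lee_fin.
  have bu n : bmeas (u n) by have [] := Hs (nnsfun_approx measurableT mE n).
  have c1 := bpc_cvg H1 bu bg uM ug.
  have c2 := bpc_cvg H2 bu bg uM ug.
  rewrite -(cvg_lim (@norm_hausdorff _ _) c1) -(cvg_lim (@norm_hausdorff _ _) c2).
  by congr (limn _); apply/funext => n; have [] := Hs (nnsfun_approx measurableT mE n).
move=> g bg; have [mg [M gM]] := bg.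
have := Hp (fun x => 1 * g x + M) (bmeas_lin 1 bg (bmeas_cst M)).
rewrite !bpc_lin//; try exact: bmeas_cst.
rewrite (Hp (fun=> M))//; try exact: bmeas_cst.
- rewrite !mul1r => H; apply: (addIr _ (H _)) => x; rewrite -lerBlDr sub0r.
  by have := gM x; rewrite mul1r ler_norml => /andP[].
- by move=> x; exact: le_trans (normr_ge0 (g x)) (gM x).
Qed.

Lemma Rintegral_bpc (mu : {finite_measure set T -> \bar R}) :
  bpc_functional (fun g => \int[mu]_x g x).
Proof.
split=> [a g1 g2 b1 b2|u g M bu bg uM ug].
  rewrite RintegralD//; first by rewrite RintegralZl//; exact: bmeas_integrable.
  - apply: (@bmeas_integrable mu (fun x => a * g1 x)); rewrite (_ : (fun x => _) = (fun x => a * g1 x + 0)).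
      by apply: bmeas_lin => //; exact: bmeas_cst.
    by apply/funext => x; rewrite addr0.
  - exact: bmeas_integrable.
have [] := @dominated_convergence _ _ _ mu setT measurableT
  (fun n => EFin \o u n) (EFin \o g) (cst M%:E).
- by move=> n; apply/measurable_EFinP; case: (bu n).
- by apply/measurable_EFinP; case: bg.
- by apply: aeW => x _; apply/fine_cvgP; split; [exact: nearW|exact: ug].
- exact: (bmeas_integrable mu (bmeas_cst M)).
- by apply: aeW => x n _; rewrite /= lee_fin.
move=> ig _ H; apply: fine_cvg; rewrite fineK; first exact: H.
exact: integrable_fin_num.
Qed.

End BoundedMeasurable.

(** * Measures represented by positive normalized functionals *)

Section DaniellMeasure.
Context {d : measure_display} {T : measurableType d} {R : realType}.
Variable L : (T -> R) -> R.
Hypothesis L_bpc : bpc_functional L.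
Hypothesis L_ge0 : forall g, bmeas g -> (forall x, 0 <= g x) -> 0 <= L g.
Hypothesis L1 : L (fun=> 1) = 1.

(** The absolute value makes the set function nonnegative on nonmeasurable sets as well, where
    [L_ge0] says nothing; on measurable sets it changes nothing. *)
Definition daniell (D : set T) : \bar R := (`|L (\1_D)|)%:E.

Let daniellE D : measurable D -> daniell D = (L (\1_D))%:E.
Proof. by move=> mD; rewrite /daniell ger0_norm// L_ge0//; exact: bmeas_indic. Qed.

Let daniell0 : daniell set0 = 0%E.
Proof. by rewrite daniellE// (_ : \1_set0 = fun=> 0) ?bpc0// indic0. Qed.

Let daniell_ge0 D : (0 <= daniell D)%E.
Proof. by rewrite lee_fin. Qed.

Let L_disj_bigsetU (F : (set T)^nat) n : (forall i, measurable (F i)) -> trivIset setT F ->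
  L (\1_(\big[setU/set0]_(i < n) F i)) = \sum_(i < n) L (\1_(F i)).
Proof.
move=> mF tF; elim: n => [|n IH].
  by rewrite !big_ord0 (_ : \1_set0 = fun=> 0) ?bpc0// indic0.
rewrite !big_ord_recr/= -IH.
have -> : \1_(\big[setU/set0]_(i < n) F i `|` F n) =
    (fun x => 1 * \1_(\big[setU/set0]_(i < n) F i) x + \1_(F n) x) :> (T -> R).
  have dUF : \big[setU/set0]_(i < n) F i `&` F n = set0.
    rewrite (@trivIset_bigsetUI _ predT)//.
    by rewrite [X in trivIset X F](_ : _ = [set: nat])//; exact/seteqP.
  apply/funext => x; rewrite mul1r !indicE in_setU.
  have : x \notin \big[setU/set0]_(i < n) F i `&` F n by rewrite dUF in_set0.
  by rewrite in_setI; do 2 case: (_ \in _); rewrite ?addr0 ?add0r.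
rewrite bpc_lin ?mul1r//; last exact: bmeas_indic.
by apply: bmeas_indic; apply: bigsetU_measurable.
Qed.

(** The indicators of the partial unions are bounded by 1 and converge pointwise, so countable
    additivity is an instance of [bpc_cvg]. *)
Let daniell_sigma_additive : semi_sigma_additive daniell.
Proof.
move=> F mF tF mUF; rewrite daniellE//.
rewrite (_ : (fun n => _) = EFin \o (fun n => L (\1_(\big[setU/set0]_(i < n) F i)))); last first.
  apply/funext => n /=; rewrite L_disj_bigsetU// big_mkord -sumEFin.
  by apply: eq_bigr => i _; rewrite daniellE.
apply/fine_cvgP; split; first exact: nearW.
apply: (@bpc_cvg _ _ _ _ L_bpc (fun n => \1_(\big[setU/set0]_(i < n) F i)) _ 1).
- by move=> n; apply: bmeas_indic; apply: bigsetU_measurable.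
- exact: bmeas_indic.
- by move=> n x; rewrite indicE; case: (_ \in _); rewrite ?normr1 ?normr0.
move=> x; rewrite indicE; have [[i _ Fix]|NF] := pselect ((\bigcup_k F k) x).
  rewrite mem_set; last by exists i.
  apply: cvg_near_cst; exists i.+1 => // n /= ilen.
  by rewrite indicE mem_set// -bigcup_mkord; exists i.
rewrite memNset//; apply: cvg_near_cst; apply: nearW => n.
rewrite indicE memNset// -bigcup_mkord => -[i _ Fix]; apply: NF; by exists i.
Qed.

HB.instance Definition _ := isMeasure.Build _ _ _ daniell
  daniell0 daniell_ge0 daniell_sigma_additive.

Let daniell_setT : daniell setT = 1%E.
Proof. by rewrite daniellE// (_ : \1_setT = fun=> 1) ?L1// indicT. Qed.

HB.instance Definition _ := Measure_isProbability.Build _ _ _ daniell daniell_setT.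

Lemma daniell_repr : exists mu : probability T R, forall g, bmeas g -> L g = \int[mu]_x g x.
Proof.
exists daniell; apply: bpc_unique => //.
  exact: (@Rintegral_bpc _ _ _ (daniell : probability T R)).
move=> D mD; rewrite /Rintegral integral_indic// setIT.
by rewrite [X in fine X](daniellE mD).
Qed.

End DaniellMeasure.

(** * Markov operators and contraction of oscillations *)

Section Doeblin.
Context {d : measure_display} {T : measurableType d} {R : realType}.
Implicit Types (g : T -> R) (P : (T -> R) -> T -> R).

(** No kernel is part of the data: [mo_bpc] at each point stands in for the countable additivity of
    the transition probabilities. *)
Record markov_operator P : Prop := MarkovOperator {
  mo_bmeas : forall g, bmeas g -> bmeas (P g) ;
  mo_bpc : forall x, bpc_functional (P ^~ x) ;
  mo_ge0 : forall g, bmeas g -> (forall x, 0 <= g x) -> forall x, 0 <= P g x ;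
  mo_1 : forall x, P (fun=> 1) x = 1 }.

Lemma mo_affine P (a b : R) g x : markov_operator P -> bmeas g ->
  P (fun y => a * g y + b) x = a * P g x + b.
Proof.
move=> HP bg; rewrite (bpc_lin (mo_bpc HP x))//; last exact: bmeas_cst.
have -> : (fun=> b) = (fun y : T => b * 1 + 0) by apply/funext => y; rewrite mulr1 addr0.
rewrite (bpc_lin (mo_bpc HP x) b (bmeas_cst 1) (bmeas_cst 0)) (mo_1 HP).
by rewrite (bpc0 (mo_bpc HP x)) mulr1 addr0.
Qed.

Lemma bmeas_affine (a b : R) g : bmeas g -> bmeas (fun y => a * g y + b).
Proof. by move=> bg; apply: bmeas_lin => //; exact: bmeas_cst. Qed.

Lemma mo_ge P g (a : R) : markov_operator P -> bmeas g ->
  (forall y, a <= g y) -> forall x, a <= P g x.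
Proof.
move=> HP bg ag x; rewrite -subr_ge0 -(mul1r (P g x)) -mo_affine//.
apply: (mo_ge0 HP); first exact: bmeas_affine.
by move=> y; rewrite mul1r subr_ge0.
Qed.

Lemma mo_le P g (b : R) : markov_operator P -> bmeas g ->
  (forall y, g y <= b) -> forall x, P g x <= b.
Proof.
move=> HP bg gb x; rewrite -subr_ge0 addrC -mulN1r -mo_affine//.
apply: (mo_ge0 HP); first exact: bmeas_affine.
by move=> y; rewrite mulN1r addrC subr_ge0.
Qed.

Lemma markov_comp P1 P2 : markov_operator P1 -> markov_operator P2 ->
  markov_operator (fun g => P1 (P2 g)).
Proof.
move=> H1 H2; split => [g bg|x|g bg g0 x|x].
- by apply: (mo_bmeas H1); exact: (mo_bmeas H2).
- split=> [a g1 g2 b1 b2|u g M bu bg uM ug].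
    rewrite -(bpc_lin (mo_bpc H1 x)); try exact: (mo_bmeas H2).
    by congr (P1 _ x); apply/funext => y; exact: (bpc_lin (mo_bpc H2 y)).
  apply: (bpc_cvg (mo_bpc H1 x) (M := M)).
  + by move=> n; exact: (mo_bmeas H2).
  + exact: (mo_bmeas H2).
  + move=> n y; rewrite ler_norml; apply/andP; split.
      by apply: (mo_ge H2) => // z; have := uM n z; rewrite ler_norml => /andP[].
    by apply: (mo_le H2) => // z; have := uM n z; rewrite ler_norml => /andP[].
  + by move=> y; apply: (bpc_cvg (mo_bpc H2 y) (M := M)).
- by apply: (mo_ge0 H1); [exact: (mo_bmeas H2)|exact: (mo_ge0 H2)].
- rewrite (_ : P2 _ = fun=> 1) ?(mo_1 H1)//.
  by apply/funext => y; rewrite (mo_1 H2).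
Qed.

Lemma markov_iter P n : markov_operator P -> markov_operator (iter n P).
Proof.
move=> HP; elim: n => [|n IH]; last exact: (@markov_comp P (iter n P)).
split=> // x; split=> // u g M _ _ _ ug; exact: ug.
Qed.

Definition osc_le g (D : R) := forall x y, g x - g y <= D.

Lemma osc_markov P g D : markov_operator P -> bmeas g -> osc_le g D -> osc_le (P g) D.
Proof.
move=> HP bg gD x y; rewrite lerBlDr; apply: (mo_le HP) => // z.
by rewrite -lerBlDl; apply: (mo_ge HP) => // w; rewrite lerBlDl -lerBlDr.
Qed.

(** With [a] the infimum of [g], the functions [g - a] and [a + D - g] are nonnegative with sum [D].
    Applied to them at the points [y] and [x], the lower bound [e * D] rearranges into the claim. *)
Lemma osc_doeblin P (e : R) g D : markov_operator P ->
  (forall c u v, 0 <= c -> bmeas u -> bmeas v -> (forall y, 0 <= u y) ->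
    (forall y, 0 <= v y) -> (forall y, u y + v y = c) ->
    forall x y, e * c <= P u x + P v y) ->
  bmeas g -> osc_le g D -> osc_le (P g) (D * (1 - e)).
Proof.
move=> HP He bg gD x y.
have D0 : 0 <= D by rewrite -(subrr (g x)).
have [mg [M gM]] := bg.
have hl : has_lbound (range g).
  by exists (- M) => _ [z _ <-]; have := gM z; rewrite ler_norml => /andP[].
pose a := inf (range g).
have ag z : a <= g z by apply: ge_inf => //; exists z.
have ga z : g z <= a + D.
  rewrite -lerBlDr; apply: lb_le_inf; first by exists (g z); exists z.
  by move=> _ [w _ <-]; rewrite lerBlDr addrC -lerBlDr.
have u0 z : 0 <= 1 * g z + - a by rewrite mul1r subr_ge0.
have v0 z : 0 <= -1 * g z + (a + D) by rewrite mulN1r addrC subr_ge0.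
have uv z : 1 * g z + - a + (-1 * g z + (a + D)) = D by ring.
have := He D _ _ D0 (bmeas_affine _ _ bg) (bmeas_affine _ _ bg) u0 v0 uv y x.
by rewrite !mo_affine// => H; nra.
Qed.

End Doeblin.

(** * Geometric ergodicity from a contraction over [N] steps *)

Section Ergodicity.
Context {d : measure_display} {T : measurableType d} {R : realType}.
Implicit Types (g : T -> R).
Variables (P : (T -> R) -> T -> R) (N : nat) (e : R).
Hypothesis P_markov : markov_operator P.
Hypotheses (N_gt0 : (0 < N)%N) (e_gt0 : 0 < e) (e_lt1 : e < 1).
Hypothesis P_doeblin : forall (c : R) u v, 0 <= c -> bmeas u -> bmeas v ->
  (forall y, 0 <= u y) -> (forall y, 0 <= v y) -> (forall y, u y + v y = c) ->
  forall x y, e * c <= iter N P u x + iter N P v y.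

(** A rate per step without an [N]-th root: the inequality of Bernoulli gives [1 - e <= gamma ^+ N],
    so a contraction by [1 - e] over [N] steps is at least as good as [N] contractions by
    [gamma]. *)
Let gamma := 1 - e / N%:R.

Let N_gt0R : 0 < N%:R :> R. Proof. by rewrite ltr0n. Qed.

Let eN_lt1 : e / N%:R < 1.
Proof. by rewrite ltr_pdivrMr// mul1r (lt_le_trans e_lt1)// ler1n. Qed.

Let gamma_gt0 : 0 < gamma. Proof. by rewrite subr_gt0. Qed.

Let gamma_lt1 : gamma < 1.
Proof. by rewrite ltrBlDr ltrDl divr_gt0. Qed.

Let bernoulli : 1 - e <= gamma ^+ N.
Proof.
suff H n : (n <= N)%N -> 1 - n%:R * (e / N%:R) <= gamma ^+ n.
  by apply: le_trans (H N (leqnn N)); rewrite mulrC divfK// gt_eqF.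
elim: n => [|n IH] nN; first by rewrite mul0r subr0 expr0.
have {}IH := IH (ltnW nN); have x0 : 0 < e / N%:R by rewrite divr_gt0.
rewrite exprS -[n.+1]addn1 natrD.
apply: (@le_trans _ _ (gamma * (1 - n%:R * (e / N%:R)))).
  rewrite /gamma; have n0 : 0 <= n%:R :> R by [].
  have : 0 <= n%:R * (e / N%:R) ^+ 2 by rewrite mulr_ge0// sqr_ge0.
  by move: (e / N%:R) => z; nra.
by rewrite ler_wpM2l// ltW.
Qed.

(** The factor 2 is the oscillation of a function bounded by 1. Dividing by [gamma ^+ N] pays for
    the incomplete block of [m %% N] steps, during which no contraction is claimed. *)
Let C := 2 / gamma ^+ N.

Let osc_iter m g D : bmeas g -> osc_le g D -> osc_le (iter m P g) (D / gamma ^+ N * gamma ^+ m).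
Proof.
move=> bg gD x0 y0; have D0 : 0 <= D by rewrite -(subrr (g x0)).
have Hq q : osc_le (iter (q * N) P g) (D * (1 - e) ^+ q).
  elim: q => [|q IH]; first by rewrite mul0n expr0 mulr1.
  rewrite mulSn iterD exprSr mulrA; apply: osc_doeblin => //.
    exact: markov_iter.
  by apply: mo_bmeas => //; exact: markov_iter.
rewrite [in iter m](divn_eq m N) addnC iterD.
have /(_ x0 y0) := osc_markov (markov_iter (m %% N)%N P_markov)
  (mo_bmeas (markov_iter (m %/ N * N)%N P_markov) bg) (Hq (m %/ N)%N).
move=> /le_trans; apply; rewrite -mulrA ler_wpM2l//.
rewrite {2}(divn_eq m N) exprD mulnC exprM mulrC.
have gN : 0 < gamma ^+ N by rewrite exprn_gt0.
rewrite ler_pdivlMr//; apply: ler_pM.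
- by rewrite exprn_ge0// subr_ge0 ltW.
- by rewrite exprn_ge0// ltW.
- by rewrite lerXn2r// ?nnegrE ?subr_ge0 ?ltW.
- by apply: ler_wiXn2l; rewrite ?ltW// ltnW// ltn_pmod.
Qed.

(** The value of [iter (k + m) P g] at [x] is an average of values of [iter m P g], hence differs
    from any of them by at most the oscillation of [iter m P g]. This gives both the Cauchy property
    in the number of steps and the independence of the starting point. *)
Let iter_close m k g (M : R) x y : bmeas g -> (forall z, `|g z| <= M) ->
  `|iter (k + m) P g x - iter m P g y| <= C * M * gamma ^+ m.
Proof.
move=> bg gM; have gD : osc_le g (2 * M).
  move=> z w; have := gM z; have := gM w; rewrite !ler_norml => /andP[? ?] /andP[? ?]; lra.
have H := osc_iter m bg gD.
have -> : C * M = 2 * M / gamma ^+ N by rewrite /C; ring.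
rewrite iterD; have bm := mo_bmeas (markov_iter m P_markov) bg.
rewrite ler_norml; apply/andP; split.
  by rewrite lerBrDl; apply: (mo_ge (markov_iter k P_markov) bm) => z; rewrite lerBlDr -lerBlDl H.
by rewrite lerBlDl; apply: (mo_le (markov_iter k P_markov) bm) => z; rewrite -lerBlDl H.
Qed.

Let gammaX_small (K eps : R) : 0 < eps -> exists m, K * gamma ^+ m <= eps.
Proof.
move=> eps0.
have : (K * gamma ^+ n) @[n --> \oo] --> K * 0.
  by apply: cvgMr; apply: cvg_expr; rewrite ger0_norm// ltW.
rewrite mulr0 => /cvgrPdist_le/(_ _ eps0)[m _ /(_ m (leqnn m))].
by rewrite /= sub0r normrN => H; exists m; exact: le_trans (ler_norm _) H.
Qed.

Variable x0 : T.
Let lim_iter g : R := limn (fun n => iter n P g x0).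

Let cvg_iter g : bmeas g -> cvgn (fun n => iter n P g x0).
Proof.
move=> bg; have [_ [M gM]] := bg.
apply/cauchy_cvgP/cauchy_exP => eps eps0.
have [m Hm] := @gammaX_small (C * M) (eps / 2) (divr_gt0 eps0 (ltr0n _ 2)).
exists (iter m P g x0); exists m => // n /= mn.
rewrite -(subnK mn) /ball/= distrC (le_lt_trans (iter_close _ _ x0 x0 bg gM))//.
by rewrite (le_lt_trans Hm)//; lra.
Qed.

Let lim_close g (M : R) : bmeas g -> (forall z, `|g z| <= M) ->
  forall m y, `|iter m P g y - lim_iter g| <= C * M * gamma ^+ m.
Proof.
move=> bg gM m y; rewrite distrC ler_norml; apply/andP; split.
  rewrite lerBrDl; apply: limr_ge; first exact: cvg_iter.
  exists m => // n /= mn; rewrite -(subnK mn).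
  by have := iter_close m (n - m) x0 y bg gM; rewrite ler_norml lerBrDl => /andP[].
rewrite lerBlDl; apply: limr_le; first exact: cvg_iter.
exists m => // n /= mn; rewrite -(subnK mn).
by have := iter_close m (n - m) x0 y bg gM; rewrite ler_norml lerBlDl => /andP[].
Qed.

Let lim_bpc : bpc_functional lim_iter.
Proof.
split=> [a g1 g2 b1 b2|u g M bu bg uM ug].
  apply/cvg_lim; first exact: norm_hausdorff.
  rewrite (_ : (fun n => _) = (fun n => a * iter n P g1 x0 + iter n P g2 x0)).
    by apply: cvgD; [apply: cvgMr|]; exact: cvg_iter.
  by apply/funext => n; rewrite (bpc_lin (mo_bpc (markov_iter n P_markov) x0)).
have gM x : `|g x| <= M.
  have H : `|u n x| @[n --> \oo] --> `|g x| by apply: cvg_norm; exact: ug.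
  rewrite -(cvg_lim (@norm_hausdorff _ _) H).
  by apply: limr_le; [apply/cvg_ex; eexists; exact: H|apply: nearW => n; exact: uM].
apply/cvgrPdist_le => eps eps0.
(* The error after [m] steps depends on the function through the bound [M] alone, so one [m] serves
   [g] and every [u n]; for this fixed [m], continuity of [iter m P] at [x0] finishes. *)
have e3 : 0 < eps / 3 by rewrite divr_gt0.
have [m Hm] := @gammaX_small (C * M) _ e3.
have := bpc_cvg (mo_bpc (markov_iter m P_markov) x0) bu bg uM ug.
move=> /cvgrPdist_le/(_ _ e3); apply: filterS => n Hn.
have h1 := le_trans (lim_close bg gM m x0) Hm.
have h2 := le_trans (lim_close (bu n) (uM n) m x0) Hm.
move: Hn h1 h2; rewrite !ler_norml => /andP[? ?] /andP[? ?] /andP[? ?].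
by apply/andP; split; lra.
Qed.

Let lim_fix g : bmeas g -> lim_iter (P g) = lim_iter g.
Proof.
move=> bg; rewrite /lim_iter; under eq_fun do rewrite -iterSr.
apply/cvg_lim; first exact: norm_hausdorff.
by have := cvg_iter bg; rewrite -(@cvg_shiftS _ (fun n => iter n P g x0)).
Qed.

Theorem doeblin_ergodic :
  exists mu : probability T R,
  [/\ forall g, bmeas g -> \int[mu]_x P g x = \int[mu]_x g x,
      forall nu : probability T R,
        (forall D, measurable D -> \int[nu]_x P (\1_D) x = fine (nu D)) ->
        forall D, measurable D -> nu D = mu D &
      exists C gamma : R, [/\ 0 < C, 0 < gamma < 1 &
        forall m x g (M : R), bmeas g -> (forall y, `|g y| <= M) ->
          `|iter m P g x - \int[mu]_y g y| <= C * M * gamma ^+ m]].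
Proof.
have lim_ge0 g : bmeas g -> (forall x, 0 <= g x) -> 0 <= lim_iter g.
  move=> bg g0; apply: limr_ge; first exact: cvg_iter.
  by apply: nearW => n; exact: (mo_ge0 (markov_iter n P_markov)).
have lim1 : lim_iter (fun=> 1) = 1.
  apply/cvg_lim; first exact: norm_hausdorff.
  apply: cvg_near_cst; apply: nearW => n.
  by rewrite (mo_1 (markov_iter n P_markov)).
have [mu mulim] := daniell_repr lim_bpc lim_ge0 lim1.
have muclose m x g (M : R) : bmeas g -> (forall y, `|g y| <= M) ->
    `|iter m P g x - \int[mu]_y g y| <= C * M * gamma ^+ m.
  by move=> bg gM; rewrite -mulim//; exact: lim_close.
exists mu; split.
- by move=> g bg; rewrite -!mulim ?lim_fix//; exact: mo_bmeas.
- move=> nu nuP D mD.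
  (* Invariance of [nu] is given on indicators. Both sides being continuous for bounded pointwise
     convergence, [bpc_unique] extends it to all bounded measurable functions, and then it can be
     iterated. *)
  have nu_bpc : bpc_functional (fun g => \int[nu]_x P g x).
    split=> [a g1 g2 b1 b2|u g M bu bg uM ug].
      rewrite -(bpc_lin (Rintegral_bpc nu)); try exact: mo_bmeas.
      by congr Rintegral; apply/funext => y; rewrite (bpc_lin (mo_bpc P_markov y)).
    apply: (bpc_cvg (Rintegral_bpc nu) (M := M)); try by move=> *; exact: mo_bmeas.
      move=> n y; rewrite ler_norml; apply/andP; split.
        by apply: mo_ge => // z; have := uM n z; rewrite ler_norml => /andP[].
      by apply: mo_le => // z; have := uM n z; rewrite ler_norml => /andP[].
    by move=> y; apply: (bpc_cvg (mo_bpc P_markov y) (M := M)).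
  have nuPg : forall g, bmeas g -> \int[nu]_x P g x = \int[nu]_x g x.
    apply: bpc_unique => //; first exact: Rintegral_bpc.
    by move=> E mE; rewrite nuP// /Rintegral integral_indic// setIT.
  have nuPm g m : bmeas g -> \int[nu]_x iter m P g x = \int[nu]_x g x.
    move=> bg; elim: m => [//|m IH]; rewrite -[RHS]IH.
    exact: nuPg (mo_bmeas (markov_iter m P_markov) bg).
  have bD : bmeas (\1_D : T -> R) by exact: bmeas_indic.
  have D1 y : `|\1_D y| <= 1 :> R.
    by rewrite indicE; case: (_ \in _); rewrite ?normr1 ?normr0.
  have intD (m : probability T R) : \int[m]_y \1_D y = fine (m D).
    by rewrite /Rintegral integral_indic// setIT.
  (* The integral of [iter m P (\1_D)] against [nu] equals [nu D] for every [m], while the integrand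
     converges uniformly to the constant [mu D]. *)
  suff E : fine (nu D) = fine (mu D).
    by rewrite -[LHS]fineK ?fin_num_measure// E fineK ?fin_num_measure.
  apply/eqP; rewrite -subr_eq0 -normr_le0; apply/ler_addgt0Pl => eps eps0.
  rewrite addr0; have [m Hm] := @gammaX_small (C * 1) _ eps0.
  apply: le_trans Hm; rewrite -!intD -(nuPm _ m bD).
  have cst_int (a : R) : \int[nu]_x a = a.
    rewrite (@Rintegral_cst _ _ _ nu _ measurableT).
    by have /= -> := @probability_setT _ _ _ nu; rewrite mulr1.
  have bmD := mo_bmeas (markov_iter m P_markov) bD.
  have icst (a : R) : nu.-integrable setT (EFin \o (fun=> a)).
    by apply: bmeas_integrable; exact: bmeas_cst.
  have ibD : nu.-integrable setT (EFin \o iter m P (\1_D)) by exact: bmeas_integrable.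
  rewrite ler_norml; apply/andP; split.
    rewrite lerBrDl -[leLHS]cst_int; apply: le_Rintegral => // z _.
    by have := muclose m z _ 1 bD D1; rewrite ler_norml lerBrDl => /andP[].
  rewrite lerBlDl -[leRHS]cst_int; apply: le_Rintegral => // z _.
  by have := muclose m z _ 1 bD D1; rewrite ler_norml lerBlDl => /andP[].
- exists C, gamma; split => //; last by rewrite gamma_gt0.
  by rewrite /C divr_gt0// exprn_gt0.
Qed.

End Ergodicity.

(* The library's Lebesgue measure lives on [measurableTypeR R]; [lebR] is the
   same set function, as a measure on the canonical measurable type [R]. *)
Definition lebR {R : realType} : set R -> \bar R := @lebesgue_measure R.

Section LebR.
Context {R : realType}.

Let lebR0 : @lebR R set0 = 0%E.
Proof. exact: measure0. Qed.

Let lebR_ge0 A : (0 <= @lebR R A)%E.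
Proof. exact: measure_ge0. Qed.

Let lebR_sigma_additive : semi_sigma_additive (@lebR R).
Proof. exact: (@measure_semi_sigma_additive _ _ _ (@lebesgue_measure R)). Qed.

HB.instance Definition _ := isMeasure.Build _ _ _ (@lebR R)
  lebR0 lebR_ge0 lebR_sigma_additive.

Let lebR_sigma_finite : sigma_finite setT (@lebR R).
Proof. exact: (sigma_finiteT (@lebesgue_measure R)). Qed.

HB.instance Definition _ := Measure_isSigmaFinite.Build _ _ _ (@lebR R) lebR_sigma_finite.

Lemma lebR_itv (i : interval R) :
  lebR [set` i] = (if i.1 < i.2 then (i.2 : \bar R) - i.1 else 0)%E.
Proof. exact: lebesgue_measure_itv. Qed.

End LebR.

(** * Lower bounds for images of measures under maps of the line *)

Section ChangeOfVariable.
Context {R : realType}.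
Notation leb := (@lebR R).
Local Open Scope ereal_scope.

(** A cover of [S] by open intervals is transported to a cover of [E]. The image of an interval of
    length [b - a] is enclosed in one centred at the image of an arbitrary point [x] of [S] in it,
    with radius [L * (b - a)]; this is where the factor 2 comes from. *)
Lemma lebesgue_lipschitz_image (phi : R -> R) (L : R) (S E : set R) :
  (0 < L)%R -> measurable S ->
  (forall x y, S x -> S y -> `|phi x - phi y| <= L * `|x - y|)%R ->
  E `<=` phi @` S -> leb E <= (2 * L)%:E * leb S.
Proof.
move=> L0 mS Llip ES.
have L20 : (0 < 2 * L)%R by rewrite mulr_gt0.
have [->|fS] := eqVneq (leb S) +oo; first by rewrite gt0_muley ?leey// lte_fin.
have lebE A : leb A = ((@wlength R idfun)^* A)%mu by [].
rewrite muleC -lee_pdivrMr// [leRHS]lebE [leRHS]outer_measure_open_itv_cover.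
apply: le_ereal_inf_tmp => _ [F [Fi SF] <-]; rewrite lee_pdivrMr// muleC.
have /choice[H HH] : forall k, exists H : set R, phi @` (F k `&` S) `<=` H /\
    leb H <= (2 * L)%:E * wlength idfun (F k).
  move=> k; have [[x [Fx Sx]]|nFS] := pselect (exists x, (F k `&` S) x); last first.
    exists set0; split; last by rewrite measure0 mule_ge0// lee_fin ltW.
    by move=> y [x FSx _]; case: nFS; exists x.
  have [a [b Fab]] : exists a b, F k = `]a, b[%classic.
    by have [[a b] ->] := Fi k; exists a, b.
  move: (Fx); rewrite Fab/= in_itv/= => /andP[ax xb].
  pose w := (L * (b - a))%R; exists `[(phi x - w)%R, (phi x + w)%R]%classic; split.
    move=> _ [y [Fy Sy] <-] /=; move: Fy; rewrite /= in_itv/= => /andP[ay yb].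
    rewrite in_itv/=.
    rewrite -ler_distlC (le_trans (Llip _ _ Sx Sy))// ler_wpM2l ?(ltW L0)//.
    rewrite ler_norml; apply/andP; split; lra.
  have w0 : (0 < w)%R by rewrite mulr_gt0// subr_gt0 (lt_trans ax).
  rewrite wlength_itv/= lte_fin (lt_trans ax xb) lebR_itv/= lte_fin.
  rewrite ltrBlDr -addrA ltrDl addr_gt0// -!EFinB -EFinM lee_fin /w.
  by rewrite le_eqVlt; apply/orP; left; apply/eqP; ring.
have EH : E `<=` \bigcup_k H k.
  move=> y /ES[x Sx <-]; have [k _ Fx] := SF _ Sx; exists k => //.
  by have [sub _] := HH k; apply: sub; exists x.
apply: (@le_trans _ _ (leb (\bigcup_k H k))); first by rewrite !lebE le_outer_measure.
apply: (le_trans (outer_measure_sigma_subadditive (@lebesgue_measure R) H)).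
rewrite -nneseriesZl//; first by apply: lee_nneseries => // k _; have [] := HH k.
Qed.

(** The end values of the affine map are at distance [|a| * T / 2] from its middle value, on
    opposite sides. An error of [|a| * T / 4] at each end leaves an interval of radius
    [|a| * T / 4], which the intermediate value theorem fills. *)
Lemma near_affine_surj (phi : R -> R) (a b T : R) : (0 < T)%R -> continuous phi ->
  (forall t, 0 <= t <= T -> `|phi t - (b + a * t)| <= `|a| * T / 4)%R ->
  `[(b + a * T / 2 - `|a| * T / 4)%R, (b + a * T / 2 + `|a| * T / 4)%R]%classic `<=`
  phi @` `[0%R, T]%classic.
Proof.
move=> T0 cphi phia v /=; rewrite in_itv/= => /andP[v1 v2].
have [|||t tT <-] := @IVT R phi 0 T v; [exact: ltW|exact: continuous_subspaceT| |by exists t].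
have := phia 0%R; have := phia T; rewrite !lexx (ltW T0) => /(_ isT) hT /(_ isT) h0.
move: hT h0; rewrite mulr0 addr0 !ler_norml => /andP[hT1 hT2] /andP[h01 h02].
rewrite ge_min le_max.
have [a0|a0] := ler0P a; move: v1 v2 hT1 hT2 h01 h02; rewrite ?(ler0_norm a0) ?(gtr0_norm a0) => *.
  by apply/andP; split; apply/orP; [right|left]; nra.
by apply/andP; split; apply/orP; [left|right]; nra.
Qed.

(** The hypothesis says that [c] times Lebesgue measure on [J] is below the image by [phi] of [e]
    restricted to [I]; the integral is monotone in the measure. *)
Lemma integral_image_lower (e : {measure set R -> \bar R}) (phi : R -> R) (c : R)
    (I J : set R) (F : R -> \bar R) :
  (0 <= c)%R -> measurable I -> measurable J -> measurable_fun setT phi ->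
  (forall E, measurable E -> E `<=` J -> c%:E * leb E <= e (I `&` phi @^-1` E)) ->
  measurable_fun setT F -> (forall v, 0 <= F v) ->
  c%:E * \int[leb]_(v in J) F v <= \int[e]_(t in I) F (phi t).
Proof.
move=> c0 mI mJ mphi H mF F0.
have mE E : measurable E -> measurable (phi @^-1` E).
  by move=> mE; rewrite -[X in measurable X]setTI; exact: mphi.
have mFphi : measurable_fun setT (F \o phi) by exact: measurableT_comp.
pose m2 := measure_function_pushforward__canonical__measure_function_Measure
  (mrestr e mI) mphi.
pose m1 : {measure set R -> \bar R} := mscale (NngNum c0) (mrestr leb mJ).
have m12 : forall S, measurable S -> m1 S <= m2 S.
  move=> S mS; rewrite /m1/= /mscale/= /m2/= /pushforward /mrestr.
  apply: le_trans (H (S `&` J) _ _) _; [exact: measurableI|exact: subIsetr|].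
  apply: le_measure.
  - by rewrite inE; apply: measurableI => //; apply: mE; exact: measurableI.
  - by rewrite inE; apply: measurableI => //; exact: mE.
  - by move=> x [Ix [Sx _]].
have -> : c%:E * \int[leb]_(v in J) F v = \int[m1]_(v in J) F v.
  rewrite ge0_integral_mscale//; last exact: measurable_funTS.
  by congr (_ * _)%E; apply: eq_measure_integral => S mS SJ /=; rewrite /mrestr setIidl.
apply: (le_trans (ge0_le_measure_integral m12 mJ F0 mF)).
rewrite ge0_integral_pushforward//; last exact: measurable_funTS.
rewrite (@ge0_negligible_integral _ _ _ _ _ (~` I))//; last 5 first.
- exact: measurableC.
- exact: mE.
- exact: measurable_funTS.
- by move=> x _; exact: F0.
- by rewrite /= /mrestr setICl measure0.
rewrite setDE setCK.
rewrite (@eq_measure_integral _ _ _ _ e); last first.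
  by move=> S mS SI; rewrite /= /mrestr setIidl// => x /SI[].
apply: ge0_subset_integral => //.
- by apply: measurableI => //; exact: mE.
- exact: measurable_funTS.
- by move=> x _; exact: F0.
Qed.

(** Neither injectivity nor differentiability of [phi] is involved. Being nearly affine makes the
    interval part of the image, and the Lipschitz constant gives the preimage of [E] Lebesgue
    measure at least that of [E] divided by [2 * L]. *)
Lemma change_of_variable_lower (e : {measure set R -> \bar R}) (c a b T L : R)
    (phi : R -> R) (F : R -> \bar R) :
  (0 < T)%R -> (0 < L)%R -> (0 <= c)%R -> continuous phi ->
  (forall E, measurable E -> E `<=` `[0%R, T]%classic -> c%:E * leb E <= e E) ->
  (forall t, 0 <= t <= T -> `|phi t - (b + a * t)| <= `|a| * T / 4)%R ->
  (forall t s, 0 <= t <= T -> 0 <= s <= T -> `|phi t - phi s| <= L * `|t - s|)%R ->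
  measurable_fun setT F -> (forall v, 0 <= F v) ->
  (c / (2 * L))%:E * \int[leb]_(v in `[(b + a * T / 2 - `|a| * T / 4)%R,
    (b + a * T / 2 + `|a| * T / 4)%R]) F v <= \int[e]_(t in `[0%R, T]) F (phi t).
Proof.
move=> T0 L0 c0 cphi eT phia phiL mF F0.
have mphi : measurable_fun setT phi by exact: continuous_measurable_fun.
have L20 : (0 < 2 * L)%R by rewrite mulr_gt0.
apply: integral_image_lower => //; first by rewrite divr_ge0// ltW.
move=> E mE EJ.
have mI : measurable (`[0%R, T]%classic `&` phi @^-1` E) by
  apply: measurableI => //; rewrite -[X in measurable X]setTI; exact: mphi.
apply: le_trans (eT _ mI (@subIsetl _ _ _)).
rewrite EFinM -muleA lee_wpmul2l ?lee_fin// muleC lee_pdivrMr//.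
rewrite muleC; apply: (@lebesgue_lipschitz_image phi L) => //.
  move=> x y [] /=; rewrite !in_itv/= => xT _ [yT _]; exact: phiL.
move=> v Ev; have [t tT tv] := near_affine_surj T0 cphi phia (EJ _ Ev).
by exists t => //; split => //=; rewrite tv.
Qed.

End ChangeOfVariable.

(** * Measurability and Tonelli for integrals with parameters *)

Section MeasurabilityTools.
Context {d d' d'' : measure_display} {T : measurableType d} {T1 : measurableType d'}
  {T2 : measurableType d''} {R : realType}.

Lemma measurable_fst_comp (f : T -> T1 * T2) :
  measurable_fun setT f -> measurable_fun setT (fun x => (f x).1).
Proof. by move=> mf; exact: (measurableT_comp measurable_fst mf). Qed.

Lemma measurable_snd_comp (f : T -> T1 * T2) :
  measurable_fun setT f -> measurable_fun setT (fun x => (f x).2).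
Proof. by move=> mf; exact: (measurableT_comp measurable_snd mf). Qed.

Lemma measurable_continuous_comp (h : R -> R) (f : T -> R) : continuous h ->
  measurable_fun setT f -> measurable_fun setT (fun x => h (f x)).
Proof.
by move=> ch mf; apply: (measurableT_comp _ mf); exact: continuous_measurable_fun.
Qed.

Local Open Scope ereal_scope.

Lemma measurable_integral_param (m : {sigma_finite_measure set T2 -> \bar R}) (D : set T2)
    (f : T1 -> T2 -> \bar R) : measurable D ->
  measurable_fun setT (fun p => f p.1 p.2) -> (forall x y, 0 <= f x y) ->
  measurable_fun setT (fun x => \int[m]_(y in D) f x y).
Proof.
move=> mD mf f0; pose f' (p : T1 * T2) := f p.1 p.2 * (\1_D p.2)%:E.
under eq_fun do rewrite integral_mkcond epatch_indic.
apply: (@measurable_fun_fubini_tonelli_F _ _ _ _ _ m f').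
  apply: emeasurable_funM => //; apply/measurable_EFinP.
  by apply: measurableT_comp => //; exact: measurable_indic.
by move=> p; rewrite mule_ge0// lee_fin.
Qed.

Lemma tonelli_domain (m1 : {sigma_finite_measure set T1 -> \bar R})
    (m2 : {sigma_finite_measure set T2 -> \bar R}) (D1 : set T1) (D2 : set T2)
    (f : T1 -> T2 -> \bar R) : measurable D1 -> measurable D2 ->
  measurable_fun setT (fun p => f p.1 p.2) -> (forall x y, 0 <= f x y) ->
  \int[m1]_(x in D1) \int[m2]_(y in D2) f x y =
  \int[m2]_(y in D2) \int[m1]_(x in D1) f x y.
Proof.
move=> mD1 mD2 mf f0.
pose f' (p : T1 * T2) := (f p.1 p.2 * (\1_D2 p.2)%:E) * (\1_D1 p.1)%:E.
have mf' : measurable_fun setT f'.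
  apply: emeasurable_funM; [apply: emeasurable_funM => //|];
    by apply/measurable_EFinP; apply: measurableT_comp => //; exact: measurable_indic.
have f'0 p : 0 <= f' p by rewrite /f' !mule_ge0// lee_fin.
have mfx x : measurable_fun setT (f x) by exact: (measurableT_comp mf (pair1_measurable x)).
have mfy y : measurable_fun setT (f ^~ y) by exact: (measurableT_comp mf (pair2_measurable y)).
transitivity (\int[m1]_x \int[m2]_y f' (x, y)).
  rewrite integral_mkcond epatch_indic; apply: eq_integral => x _ /=.
  rewrite -ge0_integralZr//; last exact: measurable_funTS.
  by rewrite integral_mkcond epatch_indic; apply: eq_integral => y _ /=; rewrite /f'/= muleAC.
rewrite (@fubini_tonelli _ _ _ _ _ m1 m2 f' mf' f'0).
rewrite [RHS]integral_mkcond epatch_indic; apply: eq_integral => y _ /=.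
rewrite -ge0_integralZr//; last exact: measurable_funTS.
by rewrite integral_mkcond epatch_indic; apply: eq_integral => x _ /=; rewrite /f'/= muleAC.
Qed.

End MeasurabilityTools.

Ltac meas := repeat lazymatch goal with
  | |- measurable_fun setT (fun _ => ?c) => exact: measurable_cst
  | |- measurable_fun setT (fun x => x) => exact: measurable_id
  | |- measurable_fun setT (fun x => (@?f x, @?g x)) => apply: (@measurable_fun_pair _ _ _ _ _ _ f g)
  | |- measurable_fun setT (fun x => (@?f x).1) => apply: (@measurable_fst_comp _ _ _ _ _ _ f)
  | |- measurable_fun setT (fun x => (@?f x).2) => apply: (@measurable_snd_comp _ _ _ _ _ _ f)
  | |- measurable_fun setT (fun x => @?f x - @?g x) => apply: (@measurable_funB _ _ _ _ f g)
  | |- measurable_fun setT (fun x => @?f x + @?g x) => apply: (@measurable_funD _ _ _ _ f g)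
  | |- measurable_fun setT (fun x => @?f x * @?g x) => apply: (@measurable_funM _ _ _ _ f g)
  | |- measurable_fun setT (fun x => ?h (@?f x)) =>
      apply: (@measurable_continuous_comp _ _ _ h f); [by []|]
  end.

(** * The shear flows on [R^3] *)

Section Flows.
Context {R : realType}.
Implicit Types (t : R) (y : R * R * R) (G : R * R * R -> \bar R).

(** [F] stands for a lift and [D] for its derivative. They are kept as separate parameters: the
    minorization treats them as two functions, and [D] becomes [derive1 F] when the flows on the
    torus are identified. *)
Definition flow1 (F D : R -> R) t y : R * R * R :=
  (y.1.1 + t * F y.2, y.1.2 + t * D y.2, y.2).

Definition flow2 (F D : R -> R) t y : R * R * R :=
  (y.1.1, y.1.2 + t * F y.1.1, y.2 + t * D y.1.1).

Definition flow3 (F D : R -> R) t y : R * R * R :=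
  (y.1.1 + t * D y.1.2, y.1.2, y.2 + t * F y.1.2).

Lemma measurable_flow1 F D : continuous F -> continuous D ->
  measurable_fun setT (fun p => flow1 F D p.1 p.2).
Proof. by move=> cF cD; rewrite /flow1; meas. Qed.

Lemma measurable_flow2 F D : continuous F -> continuous D ->
  measurable_fun setT (fun p => flow2 F D p.1 p.2).
Proof. by move=> cF cD; rewrite /flow2; meas. Qed.

Lemma measurable_flow3 F D : continuous F -> continuous D ->
  measurable_fun setT (fun p => flow3 F D p.1 p.2).
Proof. by move=> cF cD; rewrite /flow3; meas. Qed.

End Flows.

Section IntegralTools.
Context {d : measure_display} {T : measurableType d} {R : realType}.
Local Open Scope ereal_scope.

Lemma scaled_integral_le (m : {measure set T -> \bar R}) (D : set T) (c : R)
    (f g : T -> \bar R) : (0 <= c)%R -> measurable D ->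
  measurable_fun setT f -> measurable_fun setT g ->
  (forall t, 0 <= f t) -> (forall t, 0 <= g t) ->
  (forall t, D t -> c%:E * f t <= g t) ->
  c%:E * \int[m]_(t in D) f t <= \int[m]_(t in D) g t.
Proof.
move=> c0 mD mf mg f0 g0 fg; rewrite -ge0_integralZl_EFin//; last exact: measurable_funTS.
apply: ge0_le_integral => //.
- by move=> t _; rewrite mule_ge0// lee_fin.
- by apply: measurable_funTS; apply: emeasurable_funM => //; exact: measurable_cst.
- exact: measurable_funTS.
Qed.

Lemma integral_domain_le (m : {measure set T -> \bar R}) (D : set T) (g : T -> \bar R) :
  measurable D -> measurable_fun setT g -> (forall t, 0 <= g t) ->
  \int[m]_(t in D) g t <= \int[m]_t g t.
Proof. by move=> mD mg g0; apply: ge0_subset_integral. Qed.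

End IntegralTools.

(** * Minorization by Lebesgue measure on a box, near the base point *)

Section Minorization.
Context {R : realType}.
Local Open Scope ereal_scope.

(** The constant may depend on [T], as it must for a law whose density decays at infinity. *)
Definition dominates_lebesgue (e : {measure set R -> \bar R}) := forall T : R, (0 < T)%R ->
  exists2 c : R, (0 < c)%R &
    forall E, measurable E -> E `<=` `[0%R, T]%classic -> c%:E * lebR E <= e E.

(* The three integrations are changed to the coordinates of the end point one
   at a time: [r] to the third coordinate [C], [t] to the second one [B], and,
   after Tonelli, [s] to the first one. *)
Lemma fubini_minorization (e : probability R R) (G : R * R * R -> \bar R)
    (fl : R -> R -> R -> R * R * R) (A : R -> R -> R -> R)
    (I1 I2 I3 J1 J2 J3 : set R) (K1 K2 K3 : R) :
  measurable I1 -> measurable I2 -> measurable I3 ->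
  measurable J1 -> measurable J2 -> measurable J3 ->
  (0 <= K1)%R -> (0 <= K2)%R -> (0 <= K3)%R ->
  measurable_fun setT G -> (forall y, 0 <= G y) ->
  measurable_fun setT (fun p => fl p.1.1 p.1.2 p.2) ->
  measurable_fun setT (fun p => A p.1.1 p.1.2 p.2) ->
  forall H : R -> R -> \bar R, measurable_fun setT (fun p => H p.1 p.2) ->
  (forall s t, 0 <= H s t) ->
  (forall s t, I1 s -> I2 t -> K3%:E * H s t <= \int[e]_(r in I3) G (fl s t r)) ->
  (forall s, I1 s ->
    K2%:E * \int[lebR]_(B in J2) \int[lebR]_(C in J3) G (A s B C, B, C) <=
    \int[e]_(t in I2) H s t) ->
  (forall B C, J2 B -> J3 C ->
    K1%:E * \int[lebR]_(a in J1) G (a, B, C) <= \int[e]_(s in I1) G (A s B C, B, C)) ->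
  (K1 * K2 * K3)%:E *
    \int[lebR]_(B in J2) \int[lebR]_(C in J3) \int[lebR]_(a in J1) G (a, B, C) <=
  \int[e]_s \int[e]_t \int[e]_r G (fl s t r).
Proof.
move=> mI1 mI2 mI3 mJ1 mJ2 mJ3 K10 K20 K30 mG G0 mfl mA H mH H0 Hr Ht Hs.
have mGfl : measurable_fun setT (fun p => G (fl p.1.1 p.1.2 p.2)).
  exact: measurableT_comp.
have mst : measurable_fun setT (fun p : R * R => \int[e]_r G (fl p.1 p.2 r)).
  exact: (@measurable_integral_param _ _ _ _ R e setT (fun p r => G (fl p.1 p.2 r))).
have ms : measurable_fun setT (fun s => \int[e]_t \int[e]_r G (fl s t r)).
  apply: (@measurable_integral_param _ _ _ _ R e setT (fun s t => \int[e]_r G (fl s t r))) => //.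
  by move=> s t; exact: integral_ge0.
have mGA : measurable_fun setT (fun p => G (A p.1.1 p.1.2 p.2, p.1.2, p.2)).
  by apply: measurableT_comp => //; meas.
have mGa : measurable_fun setT (fun p : R * R * R => G (p.2, p.1.1, p.1.2)).
  by apply: measurableT_comp => //; meas.
have mBC : measurable_fun setT (fun p : R * R => \int[lebR]_(a in J1) G (a, p.1, p.2)).
  exact: (@measurable_integral_param _ _ _ _ R lebR J1 (fun p a => G (a, p.1, p.2))).
have mBCs : measurable_fun setT (fun p : R * R => \int[e]_(s in I1) G (A s p.1 p.2, p.1, p.2)).
  apply: (@measurable_integral_param _ _ _ _ R e I1 (fun p s => G (A s p.1 p.2, p.1, p.2))) => //.
  apply: measurableT_comp => //; meas.
  apply: (measurableT_comp (f := fun p => A p.1.1 p.1.2 p.2)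
    (g := fun x : R * R * R => (x.2, x.1.1, x.1.2))) => //; meas.
have mBs : measurable_fun setT (fun p : R * R => \int[lebR]_(C in J3) G (A p.1 p.2 C, p.2, C)).
  exact: (@measurable_integral_param _ _ _ _ R lebR J3 (fun p C => G (A p.1 p.2 C, p.2, C))).
(* Once the end coordinates [B] and [C] are frozen, [s] acts through the first coordinate [A s B C]
   alone. *)
have step_s : K1%:E * \int[lebR]_(B in J2) \int[lebR]_(C in J3) \int[lebR]_(a in J1) G (a, B, C) <=
    \int[lebR]_(B in J2) \int[lebR]_(C in J3) \int[e]_(s in I1) G (A s B C, B, C).
  apply: scaled_integral_le => //.
  - apply: (@measurable_integral_param _ _ _ _ R lebR J3
      (fun B C => \int[lebR]_(a in J1) G (a, B, C))) => // *; exact: integral_ge0.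
  - apply: (@measurable_integral_param _ _ _ _ R lebR J3
      (fun B C => \int[e]_(s in I1) G (A s B C, B, C))) => // *; exact: integral_ge0.
  - by move=> B; apply: integral_ge0 => C _; exact: integral_ge0.
  - by move=> B; apply: integral_ge0 => C _; exact: integral_ge0.
  move=> B JB; apply: scaled_integral_le => //.
  - exact: (measurableT_comp mBC (pair1_measurable B)).
  - exact: (measurableT_comp mBCs (pair1_measurable B)).
  - by move=> C; exact: integral_ge0.
  - by move=> C; exact: integral_ge0.
  - by move=> C JC; exact: Hs.
have swap : \int[lebR]_(B in J2) \int[lebR]_(C in J3) \int[e]_(s in I1) G (A s B C, B, C) =
    \int[e]_(s in I1) \int[lebR]_(B in J2) \int[lebR]_(C in J3) G (A s B C, B, C).
  transitivity (\int[lebR]_(B in J2) \int[e]_(s in I1) \int[lebR]_(C in J3) G (A s B C, B, C)).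
    apply: eq_integral => B _.
    apply: (@tonelli_domain _ _ _ _ R lebR e J3 I1 (fun C s => G (A s B C, B, C))) => //.
    apply: (measurableT_comp mGA (g := fun p : R * R => (p.2, B, p.1))); meas.
  apply: (@tonelli_domain _ _ _ _ R lebR e J2 I1
    (fun B s => \int[lebR]_(C in J3) G (A s B C, B, C))) => //.
    by apply: (measurableT_comp mBs (g := fun p : R * R => (p.2, p.1))); meas.
  by move=> B s; exact: integral_ge0.
have step_t : (K2 * K3)%:E * \int[e]_(s in I1) \int[lebR]_(B in J2) \int[lebR]_(C in J3) G (A s B C, B, C) <=
    \int[e]_(s in I1) \int[e]_t \int[e]_r G (fl s t r).
  apply: scaled_integral_le => //.
  - by rewrite mulr_ge0.
  - apply: (@measurable_integral_param _ _ _ _ R lebR J2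
      (fun s B => \int[lebR]_(C in J3) G (A s B C, B, C))) => //.
    by move=> *; exact: integral_ge0.
  - by move=> s; apply: integral_ge0 => B _; exact: integral_ge0.
  - by move=> s; apply: integral_ge0 => B _; exact: integral_ge0.
  move=> s Is; rewrite mulrC EFinM -muleA.
  apply: (@le_trans _ _ (K3%:E * \int[e]_(t in I2) H s t)).
    by apply: lee_wpmul2l; rewrite ?lee_fin// Ht.
  have mHs : measurable_fun setT (H s) by exact: (measurableT_comp mH (pair1_measurable s)).
  have mts : measurable_fun setT (fun t => \int[e]_r G (fl s t r)).
    exact: (measurableT_comp mst (pair1_measurable s)).
  apply: (@le_trans _ _ (\int[e]_(t in I2) \int[e]_r G (fl s t r))); last first.
    by apply: integral_domain_le => // t; exact: integral_ge0.
  apply: scaled_integral_le => //; first by move=> t; exact: integral_ge0.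
  move=> t It; apply: le_trans (Hr _ _ Is It) _; apply: integral_domain_le => //.
  exact: (measurableT_comp mGfl (pair1_measurable (s, t))).
rewrite -mulrA mulrC EFinM -muleA.
apply: (@le_trans _ _ ((K2 * K3)%:E *
    \int[lebR]_(B in J2) \int[lebR]_(C in J3) \int[e]_(s in I1) G (A s B C, B, C))).
  by apply: lee_wpmul2l; rewrite ?lee_fin ?mulr_ge0.
rewrite swap; apply: (le_trans step_t); apply: integral_domain_le => // s.
by apply: integral_ge0 => t _; exact: integral_ge0.
Qed.

End Minorization.

Section BaseMinorization.
Context {R : realType}.

(** The first coordinate is innermost because it is the last to be substituted, for frozen [B] and
    [C]. *)
Definition box_integral (l u : R * R * R) (G : R * R * R -> \bar R) : \bar R :=
  (\int[lebR]_(B in `[l.1.2, u.1.2]) \int[lebR]_(C in `[l.2, u.2])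
     \int[lebR]_(a in `[l.1.1, u.1.1]) G (a, B, C))%E.

Lemma continuous_delta (f : R -> R) (x eps : R) : continuous f -> 0 < eps ->
  exists2 del : R, 0 < del & forall u, `|u - x| <= del -> `|f u - f x| <= eps.
Proof.
move=> cf eps0; have /cvgrPdist_le/(_ _ eps0) := cf x.
rewrite -nbhs_ballE => -[del /= del0 H]; exists (del / 2); first by rewrite divr_gt0.
move=> u ux; rewrite distrC; apply: H; rewrite /ball/= distrC (le_lt_trans ux)//.
by rewrite ltr_pdivrMr// mulr_natr mulr2n ltrDl.
Qed.

Lemma near_box (x : R * R * R) (del : R) : 0 < del ->
  \forall y \near x, [/\ `|y.1.1 - x.1.1| <= del, `|y.1.2 - x.1.2| <= del & `|y.2 - x.2| <= del].
Proof.
move=> del0; have := nbhsx_ballx x del del0; apply: filterS => w [[/= h1 h2] h3].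
by split; rewrite distrC ltW.
Qed.

Lemma normr_scaled_le (s T a b : R) : 0 <= s <= T -> `|a| <= b -> `|s * a| <= T * b.
Proof. by move=> /andP[s0 sT] ab; rewrite normrM (ger0_norm s0) ler_pM. Qed.

Lemma norm_add_le (a b c d : R) : `|a| <= c -> `|b| <= d -> `|a + b| <= c + d.
Proof. by move=> ac bd; rewrite (le_trans (ler_normD _ _))// lerD. Qed.

(** The interval that [near_affine_surj] guarantees in the image of [[0, T]] by a map close to
    [b + a * t]. It is centred at the middle value, not at [b]. *)
Definition inner_itv (a b T : R) : set R := `[b + a * T / 2 - `|a| * T / 4, b + a * T / 2 + `|a| * T / 4].

Lemma inner_itv_dist (a b T v : R) : 0 < T -> inner_itv a b T v -> `|v - b| <= `|a| * T.
Proof.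
move=> T0; rewrite /inner_itv/= in_itv/= => /andP[v1 v2].
by rewrite ler_norml; apply/andP; split; move: v1 v2; have [a0|a0] := ler0P a; nra.
Qed.

(** The slopes [p] of [flow3] and [q] of [flow2] eliminate times in favour of end coordinates. Each
    fraction 1/16 or 1/8 is a share of the error 1/4 that [change_of_variable_lower] tolerates:
    three shares of 1/16 for the first and second coordinates, two of 1/8 for the third. [eta]
    bounds [p] and keeps the first coordinate close to that of [flow1] alone. [K] is the Lipschitz
    constant of [s |-> A s B C]: [2 * |a1|] comes from [u], and the bracket from the product rule
    for [q (u s) * (B - w s)]. *)
Lemma point_minorization (e : probability R R) (F1 D1 F2 D2 F3 D3 p q : R -> R)
    (x1 x2 z a1 a2 a3 Lq T1 T2 d1 d2 eta Mq c1 c2 c3 : R) (y : R * R * R) :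
  let K := 2 * `|a1| + eta * (Mq * (`|a2| * T2 / (16 * T1)) +
    Lq * (2 * `|a1|) * (T2 * (2 * `|a2|))) in
  continuous F1 -> continuous D1 -> continuous F2 -> continuous D2 ->
  continuous F3 -> continuous D3 -> continuous p -> continuous q ->
  0 <= c1 -> 0 <= c2 -> 0 <= c3 ->
  (forall E, measurable E -> E `<=` `[0%R, T1]%classic -> (c1%:E * lebR E <= e E)%E) ->
  (forall E, measurable E -> E `<=` `[0%R, T2]%classic -> (c2%:E * lebR E <= e E)%E) ->
  (forall E, measurable E -> E `<=` `[(0 : R), 1]%classic -> (c3%:E * lebR E <= e E)%E) ->
  0 < `|a1| -> 0 < `|a2| -> 0 < `|a3| -> 0 < T1 -> 0 < T2 -> 0 <= eta -> 0 <= Mq -> 0 <= Lq ->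
  (forall u, `|u - x1| <= d1 -> [/\ q u * F2 u = D2 u, `|F2 u - a2| <= `|a2| / 16 & `|q u| <= Mq]) ->
  (forall u v, `|u - x1| <= d1 -> `|v - x1| <= d1 -> `|q u - q v| <= Lq * `|u - v|) ->
  (forall B, `|B - x2| <= d2 -> [/\ p B * F3 B = D3 B, `|F3 B - a3| <= `|a3| / 8 & `|p B| <= eta]) ->
  2 * `|a1| * T1 <= d1 / 2 -> 2 * `|a2| * T2 <= d2 ->
  T2 * (2 * `|a2|) * Mq <= `|a3| / 16 -> eta * (2 * `|a3|) <= `|a1| * T1 / 16 ->
  `|y.1.1 - x1| <= `|a1| * T1 / 16 -> `|y.1.1 - x1| <= d1 / 2 ->
  `|y.1.2 - x2| <= `|a2| * T2 / 16 -> `|y.2 - z| <= `|a3| / 16 ->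
  `|F1 y.2 - a1| <= `|a1| / 16 -> `|D1 y.2| <= `|a2| * T2 / (16 * T1) ->
  forall G, measurable_fun setT G -> (forall x, 0 <= G x)%E ->
  ((c1 / (2 * K) * (c2 / (2 * (2 * `|a2|))) * (c3 / (2 * (2 * `|a3|))))%:E *
    \int[lebR]_(B in inner_itv a2 x2 T2) \int[lebR]_(C in inner_itv a3 z 1)
      \int[lebR]_(a in inner_itv a1 x1 T1) G (a, B, C) <=
  \int[e]_s \int[e]_t \int[e]_r G (flow3 F3 D3 r (flow2 F2 D2 t (flow1 F1 D1 s y))))%E.
Proof.
case: y => [[y1 y2] y3] K cF1 cD1 cF2 cD2 cF3 cD3 cp cq c10 c20 c30 e1 e2 e3 n1 n2 n3 T10 T20.
move=> eta0 Mq0 Lq0 near1 q_lip near2 T1d T2d T2M etaT /= hy1 hy1' hy2 hy3 hF1 hD1 G mG G0.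
pose u s := y1 + s * F1 y3.
pose w s := y2 + s * D1 y3.
pose Bt s t := w s + t * F2 (u s).
(* Along [flow3] the first coordinate moves [p] times as much as the third, and along [flow2] the
   third moves [q] times as much as the second. Hence the third coordinate before [flow3] is
   [y3 + q (u s) * (B - w s)], and the end value of the first one depends on [s], [B], [C] without
   [t] or [r]. *)
pose A s B C := u s + p B * (C - (y3 + q (u s) * (B - w s))).
have a2T2 := mulr_gt0 n2 T20; have a1T1 := mulr_gt0 n1 T10.
have nF1 : `|F1 y3| <= 2 * `|a1|.
  by have := norm_add_le hF1 (lexx `|a1|); rewrite subrK => H; apply: (le_trans H); move: n1 n2 n3 a1T1 a2T2 T1d T2d T2M etaT; clear=> *; lra.
have u_near s : 0 <= s <= T1 -> `|u s - x1| <= d1.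
  move=> sT; have := norm_add_le hy1' (normr_scaled_le sT nF1).
  rewrite (_ : y1 - x1 + s * F1 y3 = u s - x1); last by rewrite /u; ring.
  by move=> H; apply: (le_trans H); move: n1 n2 n3 a1T1 a2T2 T1d T2d T2M etaT; clear=> *; lra.
have w_near s : 0 <= s <= T1 -> `|w s - x2| <= `|a2| * T2 / 8.
  move=> sT; have := norm_add_le hy2 (normr_scaled_le sT hD1).
  rewrite (_ : y2 - x2 + s * D1 y3 = w s - x2); last by rewrite /w; ring.
  move=> H; apply: (le_trans H).
  suff -> : T1 * (`|a2| * T2 / (16 * T1)) = `|a2| * T2 / 16 by lra.
  by field; rewrite gt_eqF.
have nF2 s : 0 <= s <= T1 -> `|F2 (u s)| <= 2 * `|a2|.
  move=> sT; have [_ H _] := near1 _ (u_near _ sT).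
  by have := norm_add_le H (lexx `|a2|); rewrite subrK => H'; apply: (le_trans H'); move: n1 n2 n3 a1T1 a2T2 T1d T2d T2M etaT; clear=> *; lra.
have Bt_aff s t : 0 <= s <= T1 -> 0 <= t <= T2 -> `|Bt s t - (x2 + a2 * t)| <= `|a2| * T2 / 4.
  move=> sT tT; have [_ H _] := near1 _ (u_near _ sT).
  have := norm_add_le (w_near _ sT) (normr_scaled_le tT H).
  rewrite (_ : w s - x2 + t * (F2 (u s) - a2) = Bt s t - (x2 + a2 * t)); last by rewrite /Bt; ring.
  by move=> H'; apply: (le_trans H'); move: n1 n2 n3 a1T1 a2T2 T1d T2d T2M etaT; clear=> *; lra.
have Bt_near s t : 0 <= s <= T1 -> 0 <= t <= T2 -> `|Bt s t - x2| <= d2.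
  move=> sT tT.
  have := norm_add_le (Bt_aff _ _ sT tT) (normr_scaled_le tT (lexx `|a2|)).
  rewrite (_ : Bt s t - (x2 + a2 * t) + t * a2 = Bt s t - x2); last by ring.
  by move=> H'; apply: (le_trans H'); move: n1 n2 n3 a1T1 a2T2 T1d T2d T2M etaT; clear=> *; lra.
have J2_near B : inner_itv a2 x2 T2 B -> `|B - x2| <= d2.
  by move=> /(inner_itv_dist T20) H; apply: (le_trans H); move: n1 n2 n3 a1T1 a2T2 T1d T2d T2M etaT; clear=> *; lra.
have C_near s t : 0 <= s <= T1 -> 0 <= t <= T2 ->
    `|y3 + q (u s) * (t * F2 (u s)) - z| <= `|a3| / 8.
  move=> sT tT; have [_ _ Hq] := near1 _ (u_near _ sT).
  have H1 : `|q (u s) * (t * F2 (u s))| <= Mq * (T2 * (2 * `|a2|)).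
    by rewrite normrM ler_pM// normr_scaled_le// nF2.
  have := norm_add_le hy3 H1.
  rewrite (_ : y3 - z + q (u s) * (t * F2 (u s)) = y3 + q (u s) * (t * F2 (u s)) - z); last by ring.
  by move=> H; apply: (le_trans H); move: T2M; rewrite [_ * Mq]mulrC; move: n3; clear=> *; lra.
have Bw_near s B : 0 <= s <= T1 -> inner_itv a2 x2 T2 B -> `|B - w s| <= T2 * (2 * `|a2|).
  move=> sT /(inner_itv_dist T20); have := w_near _ sT; move: a2T2; clear=> a2T2.
  by rewrite !ler_norml => /andP[? ?] /andP[? ?]; apply/andP; split; lra.
have A_aff s B C : 0 <= s <= T1 -> inner_itv a2 x2 T2 B -> inner_itv a3 z 1 C ->
    `|A s B C - (x1 + a1 * s)| <= `|a1| * T1 / 4.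
  move=> sT JB JC; have [_ _ Hq] := near1 _ (u_near _ sT).
  have [_ _ Hp] := near2 _ (J2_near _ JB).
  have H1 : `|q (u s) * (B - w s)| <= Mq * (T2 * (2 * `|a2|)).
    by rewrite normrM ler_pM// Bw_near.
  have H2 : `|C - (y3 + q (u s) * (B - w s))| <= 2 * `|a3|.
    move: n3 (inner_itv_dist ltr01 JC) hy3 H1 T2M; clear=> n3.
    rewrite [_ * Mq]mulrC mulr1 !ler_norml.
    move=> /andP[? ?] /andP[? ?] /andP[? ?] ?.
    by apply/andP; split; lra.
  have H3 : `|p B * (C - (y3 + q (u s) * (B - w s)))| <= eta * (2 * `|a3|).
    by rewrite normrM ler_pM.
  have := norm_add_le (norm_add_le hy1 (normr_scaled_le sT hF1)) H3.
  rewrite (_ : y1 - x1 + s * (F1 y3 - a1) + p B * (C - (y3 + q (u s) * (B - w s))) =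
    A s B C - (x1 + a1 * s)); last by rewrite /A /u; ring.
  by move=> H; apply: (le_trans H); move: n1 n2 n3 a1T1 a2T2 T1d T2d T2M etaT; clear=> *; lra.
have K0 : 0 < K.
  rewrite /K ltr_wpDr// ?mulr_gt0// mulr_ge0// addr_ge0// ?mulr_ge0// ?invr_ge0 ?mulr_ge0// ltW//.
have A_lip s s' B C : 0 <= s <= T1 -> 0 <= s' <= T1 -> inner_itv a2 x2 T2 B ->
    `|A s B C - A s' B C| <= K * `|s - s'|.
  move=> sT sT' JB; have [_ _ Hq] := near1 _ (u_near _ sT).
  have [_ _ Hp] := near2 _ (J2_near _ JB).
  have us : `|u s - u s'| <= 2 * `|a1| * `|s - s'|.
    rewrite (_ : u s - u s' = F1 y3 * (s - s')); last by rewrite /u; ring.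
    by rewrite normrM ler_wpM2r.
  have h1 : `|q (u s) * (w s' - w s)| <= Mq * (`|a2| * T2 / (16 * T1) * `|s - s'|).
    rewrite (_ : w s' - w s = D1 y3 * - (s - s')); last by rewrite /w; ring.
    by rewrite !normrM normrN ler_pM// ?mulr_ge0// ler_wpM2r.
  have h2 : `|(q (u s) - q (u s')) * (B - w s')| <=
      Lq * (2 * `|a1| * `|s - s'|) * (T2 * (2 * `|a2|)).
    rewrite normrM ler_pM//; last exact: Bw_near.
    by apply: le_trans (q_lip _ _ (u_near _ sT) (u_near _ sT')) _; rewrite ler_wpM2l.
  have h3 : `|- p B * (q (u s) * (w s' - w s) + (q (u s) - q (u s')) * (B - w s'))| <=
      eta * (Mq * (`|a2| * T2 / (16 * T1) * `|s - s'|) +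
        Lq * (2 * `|a1| * `|s - s'|) * (T2 * (2 * `|a2|))).
    by rewrite normrM normrN ler_pM// norm_add_le.
  have := norm_add_le us h3.
  rewrite (_ : u s - u s' + - p B * (q (u s) * (w s' - w s) + (q (u s) - q (u s')) * (B - w s')) =
    A s B C - A s' B C); last by rewrite /A; ring.
  by move=> H; apply: (le_trans H); rewrite /K le_eqVlt; apply/orP; left; apply/eqP; ring.
have mA : measurable_fun setT (fun p => A p.1.1 p.1.2 p.2) by rewrite /A /u /w; meas.
have mBt : measurable_fun setT (fun p => Bt p.1 p.2) by rewrite /Bt /u /w; meas.
(* What remains after [r] is replaced by [C]. For fixed [s] it depends on [t] through [Bt s t]
   alone, which allows the next substitution. *)
pose H s t := (\int[lebR]_(C in inner_itv a3 z 1) G (A s (Bt s t) C, Bt s t, C))%E.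
have mJ a b T : measurable (inner_itv a b T) by exact: measurable_itv.
apply: (@fubini_minorization R e G (fun s t r => flow3 F3 D3 r (flow2 F2 D2 t (flow1 F1 D1 s (y1, y2, y3))))
  A `[(0 : R), T1]%classic `[(0 : R), T2]%classic `[(0 : R), 1]%classic
  _ _ _ _ _ _ _ _ _ _ _ _ _ _ _ mG G0 _ mA H) => //.
- by rewrite divr_ge0// mulr_ge0// ltW.
- by rewrite divr_ge0// !mulr_ge0// ltW.
- by rewrite divr_ge0// !mulr_ge0// ltW.
- apply: (measurableT_comp (measurable_flow3 cF3 cD3)
    (g := fun p : R * R * R => (p.2, flow2 F2 D2 p.1.2 (flow1 F1 D1 p.1.1 (y1, y2, y3))))).
  apply/measurable_fun_pair; first exact: measurable_snd.
  apply: (measurableT_comp (measurable_flow2 cF2 cD2)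
    (g := fun p : R * R * R => (p.1.2, flow1 F1 D1 p.1.1 (y1, y2, y3)))).
  by rewrite /flow1/=; meas.
- apply: (@measurable_integral_param _ _ _ _ R lebR _
    (fun (p : R * R) C => G (A p.1 (Bt p.1 p.2) C, Bt p.1 p.2, C))) => //.
  apply: measurableT_comp => //; apply/measurable_fun_pair; last exact: measurable_snd.
  apply/measurable_fun_pair; last exact: (measurableT_comp mBt measurable_fst).
  apply: (measurableT_comp mA (g := fun p : R * R * R => (p.1.1, Bt p.1.1 p.1.2, p.2))).
  apply/measurable_fun_pair; last exact: measurable_snd.
  apply/measurable_fun_pair; last exact: (measurableT_comp mBt measurable_fst).
  by meas.
- by move=> s t; exact: integral_ge0.
- move=> s t; rewrite /= !in_itv/= => sT tT.
  have [Hq _ _] := near1 _ (u_near _ sT).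
  have [Hp HF3 _] := near2 _ (Bt_near _ _ sT tT).
  (* The third coordinate when [flow3] starts, with [D2] rewritten as [q * F2]. *)
  pose z3 := y3 + q (u s) * (t * F2 (u s)).
  pose F C := G (A s (Bt s t) C, Bt s t, C).
  have -> : (\int[e]_(r in `[0%R, 1%R])
      G (flow3 F3 D3 r (flow2 F2 D2 t (flow1 F1 D1 s (y1, y2, y3)))) =
      \int[e]_(r in `[0%R, 1%R]) F (z3 + r * F3 (Bt s t))%R)%E.
    apply: eq_integral => r _; rewrite /F /flow3 /flow2 /flow1/=.
    rewrite -/(u s) -/(w s) -/(Bt s t) -Hp -Hq; congr (G (_, _, _)).
      by rewrite /A /z3 /Bt; ring.
    by rewrite /z3; ring.
  apply: change_of_variable_lower => //.
  + by rewrite mulr_gt0.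
  + by move=> r; apply: cvgD; [exact: cvg_cst|apply: cvgMl; exact: cvg_id].
  + move=> r rT; have := norm_add_le (C_near _ _ sT tT) (normr_scaled_le rT HF3).
    rewrite (_ : y3 + q (u s) * (t * F2 (u s)) - z + r * (F3 (Bt s t) - a3) =
      z3 + r * F3 (Bt s t) - (z + a3 * r)); last by rewrite /z3; ring.
    by move=> HH; apply: (le_trans HH); move: n1 n2 n3 a1T1 a2T2 T1d T2d T2M etaT; clear=> *; lra.
  + move=> r r' _ _; rewrite (_ : _ - _ = F3 (Bt s t) * (r - r')); last by ring.
    rewrite normrM ler_wpM2r//.
    by have := norm_add_le HF3 (lexx `|a3|); rewrite subrK => HH; apply: (le_trans HH); move: n1 n2 n3 a1T1 a2T2 T1d T2d T2M etaT; clear=> *; lra.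
  + rewrite /F; apply: measurableT_comp => //; do 2 (apply/measurable_fun_pair; last by meas).
    exact: (measurableT_comp mA (pair1_measurable (s, Bt s t))).
- move=> s; rewrite /= in_itv/= => sT.
  apply: (@change_of_variable_lower R e c2 a2 x2 T2 (2 * `|a2|) (Bt s)
    (fun B => \int[lebR]_(C in inner_itv a3 z 1) G (A s B C, B, C))%E) => //.
  + by rewrite mulr_gt0.
  + by move=> t; apply: cvgD; [exact: cvg_cst|apply: cvgMl; exact: cvg_id].
  + by move=> t tT; exact: Bt_aff.
  + move=> t t' _ _; rewrite (_ : _ - _ = F2 (u s) * (t - t')); last by rewrite /Bt; ring.
    by rewrite normrM ler_wpM2r// nF2.
  + apply: (@measurable_integral_param _ _ _ _ R lebR _ (fun B C => G (A s B C, B, C))) => //.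
    apply: measurableT_comp => //; do 2 (apply/measurable_fun_pair; last by meas).
    apply: (measurableT_comp mA (g := fun p : R * R => (s, p.1, p.2))).
    by meas.
  + by move=> B; exact: integral_ge0.
- move=> B C JB JC.
  apply: (@change_of_variable_lower R e c1 a1 x1 T1 K (fun s => A s B C) (fun a => G (a, B, C))) => //.
  + have cu : continuous u by move=> s; apply: cvgD; [exact: cvg_cst|apply: cvgMl; exact: cvg_id].
    have cw : continuous w by move=> s; apply: cvgD; [exact: cvg_cst|apply: cvgMl; exact: cvg_id].
    move=> s; apply: cvgD; first exact: cu.
    apply: cvgM; first exact: cvg_cst.
    apply: cvgB; first exact: cvg_cst.
    apply: cvgD; first exact: cvg_cst.
    apply: cvgM; last by apply: cvgB; [exact: cvg_cst|exact: cw].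
    by apply: (@cvg_comp _ _ _ u q); [exact: cu|exact: cq].
  + by move=> s sT; exact: A_aff.
  + by move=> s s' sT sT'; exact: A_lip.
  + by apply: measurableT_comp => //; meas.
Qed.

End BaseMinorization.

(** * The slope [D / F] near a point where [F] does not vanish *)

Section LocalQuotient.
Context {R : realType}.
Implicit Types (D F : R -> R) (x : R).

Definition locally_lipschitz_at F x := exists2 del : R, 0 < del &
  exists2 L : R, 0 <= L & forall u v, `|u - x| <= del -> `|v - x| <= del ->
    `|F u - F v| <= L * `|u - v|.

(* [q = D * F / den] with [den = F ^+ 2] where [F ^+ 2 >= m := `|F x| ^+ 2 / 4] and
   [den >= m] elsewhere, so [q] is continuous on the whole line. *)
Lemma local_quotient D F x : continuous D -> continuous F -> F x != 0 ->
  exists (q : R -> R) (del : R), [/\ continuous q, 0 < del &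
    forall u, `|u - x| <= del -> `|F x| / 2 <= `|F u| /\ q u = D u / F u].
Proof.
move=> cD cF Fx; have a0 : 0 < `|F x| by rewrite normr_gt0.
pose m := `|F x| ^+ 2 / 4; have m0 : 0 < m by rewrite divr_gt0// exprn_gt0.
pose den u := F u ^+ 2 + (`|F u ^+ 2 - m| - (F u ^+ 2 - m)).
have den_gt0 u : 0 < den u.
  rewrite /den; have := sqr_ge0 (F u).
  by have [h|h] := leP 0 (F u ^+ 2 - m); [rewrite ger0_norm|rewrite ltr0_norm]; lra.
have [del del0 Hdel] := continuous_delta x cF (divr_gt0 a0 (ltr0n _ 2)).
exists (fun u => D u * (F u / den u)), del; split => //.
- have cF2 : continuous (fun u => F u ^+ 2).
    by move=> u; apply: (@cvgM _ _ _ _ F F); exact: cF.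
  have cFm : continuous (fun u => F u ^+ 2 - m).
    by move=> u; apply: cvgB; [exact: cF2|exact: cvg_cst].
  move=> u; apply: cvgM; first exact: cD.
  apply: cvgM; first exact: cF.
  apply: cvgV; first by rewrite gt_eqF.
  apply: cvgD; first exact: cF2.
  by apply: cvgB; [apply: cvg_norm; exact: cFm|exact: cFm].
move=> u ux; have Fu : `|F x| / 2 <= `|F u|.
  have := Hdel u ux; have := ler_distD (F u) (F x) 0; rewrite !subr0.
  by rewrite (distrC (F x) (F u)) => h1 h2; lra.
split=> //; have Fu0 : F u != 0 by rewrite -normr_gt0; apply: lt_le_trans Fu; rewrite divr_gt0.
have -> : den u = F u ^+ 2.
  have : 0 <= F u ^+ 2 - m.
    rewrite -(real_normK (num_real (F u))) /m subr_ge0.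
    have : 0 <= `|F x| / 2 by lra.
    by move: Fu; nra.
  by rewrite /den => /ger0_norm ->; lra.
by field.
Qed.

Lemma lipschitz_quotient D F q x del : continuous D ->
  locally_lipschitz_at D x -> locally_lipschitz_at F x -> F x != 0 -> 0 < del ->
  (forall u, `|u - x| <= del -> `|F x| / 2 <= `|F u| /\ q u = D u / F u) ->
  locally_lipschitz_at q x.
Proof.
move=> cD [dD dD0 [LD LD0 lipD]] [dF dF0 [LF LF0 lipF]] Fx del0 Hq.
have a0 : 0 < `|F x| by rewrite normr_gt0.
have [dM dM0 HM] := continuous_delta x cD (ltr01).
exists (Num.min (Num.min del dM) (Num.min dD dF)); first by rewrite !lt_min del0 dM0 dD0 dF0.
pose k := 2 / `|F x|; have k0 : 0 <= k by rewrite divr_ge0.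
exists ((`|D x| + 1) * LF * k ^+ 2 + LD * k).
  by rewrite addr_ge0// !mulr_ge0// addr_ge0.
move=> u v; rewrite !le_min => /andP[/andP[u1 u2] /andP[u3 u4]] /andP[/andP[v1 v2] /andP[v3 v4]].
have [Fu ->] := Hq u u1; have [Fv ->] := Hq v v1.
have inv w : `|F x| / 2 <= `|F w| -> F w != 0 /\ `|(F w)^-1| <= k.
  move=> Fw; have w0 : 0 < `|F w| by apply: lt_le_trans Fw; rewrite divr_gt0.
  split; first by rewrite -normr_gt0.
  by rewrite normfV /k -invf_div lef_pV2// posrE divr_gt0.
have [Fu0 iu] := inv u Fu; have [Fv0 iv] := inv v Fv.
have -> : D u / F u - D v / F v =
    D u * (F v - F u) * ((F u)^-1 * (F v)^-1) + (D u - D v) * (F v)^-1.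
  by field; rewrite Fu0 Fv0.
have Du : `|D u| <= `|D x| + 1.
  by have := norm_add_le (HM u u2) (lexx `|D x|); rewrite subrK addrC.
rewrite [leRHS]mulrDl; apply: norm_add_le.
  rewrite (_ : (`|D x| + 1) * LF * k ^+ 2 * `|u - v| = (`|D x| + 1) * (LF * `|u - v|) * (k * k));
    last by ring.
  have hF : `|F v - F u| <= LF * `|u - v| by rewrite distrC lipF.
  by rewrite !normrM; do ?(apply: ler_pM => //; rewrite ?mulr_ge0//).
rewrite (_ : LD * k * `|u - v| = LD * `|u - v| * k); last by ring.
by rewrite normrM ler_pM// lipD.
Qed.

End LocalQuotient.

Section BaseMinorizationNear.
Context {R : realType}.

(** The constants are fixed in the order [d1], [T1], [eta], [d2], [T2], [dy], each depending on
    earlier ones. A short [T1] keeps [u] where [q] is controlled, [eta] must be small against [T1],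
    and [d2] makes [p] smaller than [eta], possible since [D3 x2 = 0]. The neighbourhood of the
    starting point comes last, so that [D1 z = 0] can make [D1] small against [T2 / T1]. *)
Lemma base_minorization (e : probability R R) (F1 D1 F2 D2 F3 D3 : R -> R) (x1 x2 z : R) :
  dominates_lebesgue e ->
  continuous F1 -> continuous D1 -> continuous F2 -> continuous D2 ->
  continuous F3 -> continuous D3 ->
  locally_lipschitz_at F2 x1 -> locally_lipschitz_at D2 x1 ->
  F1 z != 0 -> D1 z = 0 -> F2 x1 != 0 -> F3 x2 != 0 -> D3 x2 = 0 ->
  exists l u : R * R * R, exists c : R,
    [/\ [/\ l.1.1 < u.1.1, l.1.2 < u.1.2 & l.2 < u.2], 0 < c &
      \forall y \near (x1, x2, z), forall G,
        measurable_fun setT G -> (forall x, 0 <= G x)%E ->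
        (c%:E * box_integral l u G <=
         \int[e]_s \int[e]_t \int[e]_r
           G (flow3 F3 D3 r (flow2 F2 D2 t (flow1 F1 D1 s y))))%E].
Proof.
move=> edom cF1 cD1 cF2 cD2 cF3 cD3 lipF2 lipD2 F1z D1z F2x F3x D3x.
pose a1 := F1 z; pose a2 := F2 x1; pose a3 := F3 x2.
have n1 : 0 < `|a1| by rewrite normr_gt0.
have n2 : 0 < `|a2| by rewrite normr_gt0.
have n3 : 0 < `|a3| by rewrite normr_gt0.
have [q [dq [cq dq0 Hq]]] := local_quotient cD2 cF2 F2x.
have [p [dp [cp dp0 Hp]]] := local_quotient cD3 cF3 F3x.
have [dl dl0 [Lq Lq0 q_lip]] := lipschitz_quotient cD2 lipD2 lipF2 F2x dq0 Hq.
have [dF2 dF20 HF2] := continuous_delta x1 cF2 (divr_gt0 n2 (ltr0n _ 16)).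
have [dq1 dq10 Hq1] := continuous_delta x1 cq ltr01.
pose Mq := 1 + `|q x1|; have Mq0 : 0 < Mq by rewrite ltr_wpDr.
pose d1 := Num.min (Num.min dq dl) (Num.min dF2 dq1).
have d10 : 0 < d1 by rewrite !lt_min dq0 dl0 dF20 dq10.
pose T1 := d1 / (4 * `|a1|); have T10 : 0 < T1 by rewrite divr_gt0// mulr_gt0.
pose eta := `|a1| * T1 / (32 * `|a3|).
have eta0 : 0 < eta by rewrite divr_gt0// mulr_gt0.
have [dF3 dF30 HF3] := continuous_delta x2 cF3 (divr_gt0 n3 (ltr0n _ 8)).
have [dp1 dp10 Hp1] := continuous_delta x2 cp eta0.
have px2 : p x2 = 0.
  by have [|_ ->] := Hp x2; [rewrite subrr normr0 ltW|rewrite D3x mul0r].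
pose d2 := Num.min dp (Num.min dF3 dp1).
have d20 : 0 < d2 by rewrite !lt_min dp0 dF30 dp10.
pose T2 := Num.min (d2 / (2 * `|a2|)) (`|a3| / (32 * `|a2| * Mq)).
have T20 : 0 < T2 by rewrite lt_min !divr_gt0// !mulr_gt0.
have [c1 c10 e1] := edom _ T10.
have [c2 c20 e2] := edom _ T20.
have [c3 c30 e3] := edom _ ltr01.
have [dF1 dF10 HF1] := continuous_delta z cF1 (divr_gt0 n1 (ltr0n _ 16)).
have k0 : 0 < `|a2| * T2 / (16 * T1) by rewrite divr_gt0// mulr_gt0.
have [dD1 dD10 HD1] := continuous_delta z cD1 k0.
pose K := 2 * `|a1| + eta * (Mq * (`|a2| * T2 / (16 * T1)) +
    Lq * (2 * `|a1|) * (T2 * (2 * `|a2|))).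
have K0 : 0 < K.
  rewrite /K ltr_wpDr// ?mulr_gt0// mulr_ge0// ?addr_ge0// ?mulr_ge0// ?invr_ge0 ?mulr_ge0//; exact: ltW.
pose dy := Num.min (Num.min (`|a1| * T1 / 16) (d1 / 2))
  (Num.min (Num.min (`|a2| * T2 / 16) (`|a3| / 16)) (Num.min dF1 dD1)).
have dy0 : 0 < dy.
  by rewrite !lt_min dF10 dD10 !divr_gt0// mulr_gt0.
pose lo (b a T : R) := b + a * T / 2 - `|a| * T / 4.
pose hi (b a T : R) := b + a * T / 2 + `|a| * T / 4.
have lohi (b a T : R) : 0 < `|a| -> 0 < T -> lo b a T < hi b a T.
  by move=> na T0; rewrite /lo /hi ltrD2l -subr_gt0 opprK addr_gt0// divr_gt0// mulr_gt0.
exists (lo x1 a1 T1, lo x2 a2 T2, lo z a3 1), (hi x1 a1 T1, hi x2 a2 T2, hi z a3 1).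
exists (c1 / (2 * K) * (c2 / (2 * (2 * `|a2|))) * (c3 / (2 * (2 * `|a3|)))).
split => //=.
- by split; exact: lohi.
- by rewrite !mulr_gt0// invr_gt0 !mulr_gt0.
have := near_box (x1, x2, z) dy0; apply: filterS => y [/=].
rewrite !le_min => /andP[/andP[hy1 hy1'] _] /andP[_ /andP[/andP[hy2 _] _]].
move=> /andP[_ /andP[/andP[_ hy3] /andP[hF1 hD1]]] G mG G0.
apply: (@point_minorization R e F1 D1 F2 D2 F3 D3 p q x1 x2 z a1 a2 a3 Lq T1 T2 d1 d2 eta Mq
  c1 c2 c3 y) => //; rewrite ?(ltW c10) ?(ltW c20) ?(ltW c30) ?(ltW eta0) ?(ltW Mq0)//.
- move=> u; rewrite !le_min => /andP[/andP[u1 _] /andP[u3 u4]].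
  have [Fu qu] := Hq u u1; have Fu0 : F2 u != 0.
    by rewrite -normr_gt0; apply: lt_le_trans Fu; rewrite divr_gt0.
  split; [by rewrite qu divfK|exact: HF2|].
  by have := norm_add_le (Hq1 u u4) (lexx `|q x1|); rewrite subrK.
- move=> u v; rewrite !le_min => /andP[/andP[_ u1] _] /andP[/andP[_ v1] _].
  exact: q_lip.
- move=> B; rewrite !le_min => /and3P[u1 u3 u4].
  have [Fu pu] := Hp B u1; have Fu0 : F3 B != 0.
    by rewrite -normr_gt0; apply: lt_le_trans Fu; rewrite divr_gt0.
  split; [by rewrite pu divfK|exact: HF3|].
  by have := Hp1 B u4; rewrite px2 subr0.
- rewrite /T1 le_eqVlt; apply/orP; left; apply/eqP; field; exact: lt0r_neq0.
- apply: (@le_trans _ _ (2 * `|a2| * (d2 / (2 * `|a2|)))).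
    by rewrite ler_wpM2l ?mulr_ge0// ge_min lexx.
  by rewrite le_eqVlt; apply/orP; left; apply/eqP; field; exact: lt0r_neq0.
- apply: (@le_trans _ _ ((`|a3| / (32 * `|a2| * Mq)) * (2 * `|a2|) * Mq)).
    by rewrite ler_wpM2r ?(ltW Mq0)// ler_wpM2r ?mulr_ge0// ge_min lexx orbT.
  by rewrite le_eqVlt; apply/orP; left; apply/eqP; field; rewrite !lt0r_neq0.
- rewrite /eta le_eqVlt; apply/orP; left; apply/eqP; field; exact: lt0r_neq0.
- exact: HF1.
- by have := HD1 _ hD1; rewrite D1z subr0.
Qed.

End BaseMinorizationNear.

Section ContinuityTools.
Context {T U V : topologicalType} {R : realType}.

Lemma continuous_cstf (c : U) : continuous (fun _ : T => c).
Proof. by move=> x; exact: cvg_cst. Qed.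

Lemma continuous_idf : continuous (fun x : T => x).
Proof. by move=> x; exact: cvg_id. Qed.

Lemma continuous_pair (f : T -> U) (g : T -> V) :
  continuous f -> continuous g -> continuous (fun x => (f x, g x)).
Proof. by move=> cf cg x; exact: (cvg_pair (cf x) (cg x)). Qed.

Lemma continuous_fst_comp (f : T -> U * V) : continuous f -> continuous (fun x => (f x).1).
Proof. by move=> cf x; apply: (@cvg_comp _ _ _ f fst _ _ _ (cf x)); exact: cvg_fst. Qed.

Lemma continuous_snd_comp (f : T -> U * V) : continuous f -> continuous (fun x => (f x).2).
Proof. by move=> cf x; apply: (@cvg_comp _ _ _ f snd _ _ _ (cf x)); exact: cvg_snd. Qed.

Lemma continuous_comp_fun (h : U -> V) (f : T -> U) : continuous h -> continuous f ->
  continuous (fun x => h (f x)).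
Proof. by move=> ch cf x; apply: (@cvg_comp _ _ _ f h _ _ _ (cf x)); exact: ch. Qed.

Lemma continuous_addf (f g : T -> R) : continuous f -> continuous g ->
  continuous (fun x => f x + g x).
Proof. by move=> cf cg x; exact: (cvgD (cf x) (cg x)). Qed.

Lemma continuous_mulf (f g : T -> R) : continuous f -> continuous g ->
  continuous (fun x => f x * g x).
Proof. by move=> cf cg x; exact: (cvgM (cf x) (cg x)). Qed.

End ContinuityTools.

Ltac cont := repeat lazymatch goal with
  | |- continuous (fun _ => ?c) => exact: continuous_cstf
  | |- continuous (fun x => x) => exact: continuous_idf
  | |- continuous (fun x => (@?f x, @?g x)) => apply: (@continuous_pair _ _ _ f g)
  | |- continuous (fun x => (@?f x).1) => apply: (@continuous_fst_comp _ _ _ f)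
  | |- continuous (fun x => (@?f x).2) => apply: (@continuous_snd_comp _ _ _ f)
  | |- continuous (fun x => @?f x + @?g x) => apply: (@continuous_addf _ _ f g)
  | |- continuous (fun x => @?f x * @?g x) => apply: (@continuous_mulf _ _ f g)
  | |- continuous (fun x => ?h (@?f x)) =>
      apply: (@continuous_comp_fun _ _ _ h f); [assumption|]
  end.

(** * Transport of the minorization along orbits, and compactness *)

Section Reachability.
Context {R : realType}.
Notation S := (R * R * R)%type.

Definition periodic (F : R -> R) := forall x (k : int), F (x + k%:~R * (2 * pi)) = F x.

Definition translate (k : int * int * int) (y : S) : S :=
  (y.1.1 + k.1.1%:~R * (2 * pi), y.1.2 + k.1.2%:~R * (2 * pi), y.2 + k.2%:~R * (2 * pi)).

Definition admissible (G : S -> \bar R) :=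
  [/\ measurable_fun setT G, forall y, (0 <= G y)%E & forall k y, G (translate k y) = G y].

Definition flow_average (e : set R -> \bar R) (fl : R -> S -> S) (G : S -> \bar R) (y : S) :=
  (\int[e]_t G (fl t y))%E.

Definition good_flow (fl : R -> S -> S) := [/\
  measurable_fun setT (fun p => fl p.1 p.2),
  continuous (fun p => fl p.1 p.2),
  forall t k y, fl t (translate k y) = translate k (fl t y) &
  forall y, fl 0 y = y].

(** Both [eps] and the neighbourhood precede [G]. This uniformity is what lets the property pass
    through averages and compactness. *)
Definition minorized_at (l u : S) (T : (S -> \bar R) -> S -> \bar R) (y : S) :=
  exists2 eps : R, 0 < eps & \forall x \near y, forall G, admissible G ->
    (eps%:E * box_integral l u G <= T G x)%E.

Lemma box_integral_ge0 l u (G : S -> \bar R) : (forall y, (0 <= G y)%E) -> (0 <= box_integral l u G)%E.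
Proof.
by move=> G0; do 3 (apply: integral_ge0 => ? _).
Qed.

Lemma flow_average_admissible (e : probability R R) fl G : good_flow fl ->
  admissible G -> admissible (flow_average e fl G).
Proof.
move=> [mfl _ flk _] [mG G0 Gk]; split.
- apply: (@measurable_integral_param _ _ _ _ R e setT (fun y t => G (fl t y))) => //.
  apply: measurableT_comp => //.
  apply: (measurableT_comp mfl (g := fun p : S * R => (p.2, p.1))).
  by apply/measurable_fun_pair; [exact: measurable_snd|exact: measurable_fst].
- by move=> y; exact: integral_ge0.
- by move=> k y; apply: eq_integral => t _; rewrite flk Gk.
Qed.

Section Steps.
Variables (e : probability R R) (l u : S).
Hypothesis e_dom : dominates_lebesgue e.
Implicit Types (fl : R -> S -> S) (T : (S -> \bar R) -> S -> \bar R).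

(** By joint continuity, times in [[t, t + del]] lead from a neighbourhood of [y] into the region
    where [T] is minorized, and these times have mass at least [c * del]. *)
Lemma minorized_step fl T (t : R) y : good_flow fl -> 0 <= t ->
  (forall G, admissible G -> admissible (T G)) ->
  minorized_at l u T (fl t y) -> minorized_at l u (fun G => flow_average e fl (T G)) y.
Proof.
move=> [mfl cfl flk _] t0 Tadm [eps eps0 near_fl].
have := cfl (t, y); rewrite /continuous_at/= => /(_ _ near_fl).
move=> [[U V]] /= [Ut Vy] UV.
(* The interval lies to the right of [t], so the times stay nonnegative even for [t = 0], where
   [dominates_lebesgue] gives mass. *)
have [del /= del0 Hdel] : exists2 del : R, 0 < del & forall t', t <= t' <= t + del -> U t'.
  move/nbhs_ballP : Ut => [del /= del0 H]; exists (del / 2); first by rewrite divr_gt0.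
  move=> t' /andP[t1 t2]; apply: H; rewrite /ball/= ltr_norml; apply/andP; split; lra.
have [c c0 ec] := e_dom (addr_gt0 (lt_le_trans ltr01 (ler_wpDl t0 (lexx 1))) del0).
have ec' : (c%:E * del%:E <= e `[t, (t + del)%R]%classic)%E.
  apply: le_trans (ec `[t, t + del]%classic _ _) => //; last first.
    move=> t' /=; rewrite !in_itv/= => /andP[t1 t2]; apply/andP; split; lra.
  by rewrite lebR_itv/= lte_fin ltrDl del0 -EFinB addrAC subrr add0r.
exists (eps * (c * del)); first by rewrite !mulr_gt0.
apply: filterS Vy => x Vx G Gadm.
have [mTG TG0 _] := Tadm _ Gadm.
have mTGfl : measurable_fun setT (fun t' => T G (fl t' x)).
  by apply: measurableT_comp => //; exact: (measurableT_comp mfl (pair2_measurable x)).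
have [_ G0 _] := Gadm; have b0 := box_integral_ge0 l u G0.
apply: (@le_trans _ _ (\int[e]_(t' in `[t, (t + del)%R]) cst (eps%:E * box_integral l u G) t')%E).
  rewrite integral_cst// EFinM muleAC lee_wpmul2l//; by rewrite mule_ge0// lee_fin ltW.
apply: (@le_trans _ _ (\int[e]_(t' in `[t, (t + del)%R]) T G (fl t' x))%E); last first.
  exact: integral_domain_le.
apply: ge0_le_integral => //.
- by move=> t' _; rewrite mule_ge0// lee_fin ltW.
- exact: measurable_funTS.
- by move=> t'; rewrite /= in_itv/= => tt; apply: (UV (t', x)) => //; split => //; exact: Hdel.
Qed.

Lemma minorized_stay fl T y : good_flow fl ->
  (forall G, admissible G -> admissible (T G)) ->
  minorized_at l u T y -> minorized_at l u (fun G => flow_average e fl (T G)) y.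
Proof.
move=> gfl Tadm Ty; apply: (minorized_step gfl (lexx 0)) => //.
by have [_ _ _ ->] := gfl.
Qed.

Lemma minorized_translate T k y : (forall G, admissible G -> admissible (T G)) ->
  minorized_at l u T (translate k y) -> minorized_at l u T y.
Proof.
move=> Tadm [eps eps0 H]; exists eps => //.
have ck : continuous (translate k).
  by rewrite /translate; cont.
have near_k : \forall x \near y, forall G, admissible G ->
    (eps%:E * box_integral l u G <= T G (translate k x))%E by exact: ck y _ H.
apply: filterS near_k => x Hx G Gadm; have [_ _ Tk] := Tadm _ Gadm.
by rewrite -(Tk k) Hx.
Qed.

End Steps.

Lemma reach_mod (a alpha beta : R) : a != 0 ->
  exists2 s, 0 <= s & exists k : int, alpha + s * a = beta + k%:~R * (2 * pi).
Proof.
move=> a0; have pi0 : 0 < 2 * pi :> R by rewrite mulr_gt0// pi_gt0.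
pose n := Num.bound (`|beta - alpha| / (2 * pi)).
have Hn : `|beta - alpha| < n%:R * (2 * pi).
  by rewrite -ltr_pdivrMr//; apply: archi_boundP; rewrite divr_ge0// ltW.
(* The representative of [beta] is pushed beyond [alpha] in the direction of [a], so the arrival
   time is nonnegative. *)
pose k : int := if 0 < a then n%:Z else - n%:Z.
exists ((beta + k%:~R * (2 * pi) - alpha) / a); last by exists k; rewrite divfK// addrC subrK.
move: Hn; rewrite ltr_norml => /andP[h1 h2]; rewrite /k; case: ltP => ha.
  by rewrite divr_ge0 ?(ltW ha)// -pmulrn; lra.
rewrite -[leRHS]mulrNN mulr_ge0// oppr_ge0 ?invr_le0// intrN -pmulrn.
by lra.
Qed.

(* The orbit of slope [b / a] crosses the circle [x = beta1] at points spaced by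
   [2 pi b / |a|] in the second coordinate. *)
Lemma reach_mod_torus (a b del alpha1 alpha2 beta1 beta2 : R) : a != 0 -> b != 0 ->
  2 * pi * `|b| / `|a| <= del ->
  exists2 s, 0 <= s & exists k1 k2 : int, alpha1 + s * a = beta1 + k1%:~R * (2 * pi) /\
    `|alpha2 + s * b - (beta2 + k2%:~R * (2 * pi))| <= del.
Proof.
move=> a0 b0 small; have pi0 : 0 < 2 * pi :> R by rewrite mulr_gt0// pi_gt0.
have na0 : `|a| != 0 by rewrite normr_eq0.
have [s0 s00 [k0 Hs0]] := reach_mod alpha1 beta1 a0.
pose eta := 2 * pi * b / `|a|.
have eta0 : eta != 0 by rewrite !mulf_neq0 ?invr_neq0// ?lt0r_neq0// pi_gt0.
(* Counted in returns to the circle, a real number [t] of them would reach [beta2] exactly; its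
   integer part misses by at most one spacing. *)
have [t t0 [k2 Ht]] := reach_mod (alpha2 + s0 * b) beta2 eta0.
pose n := Num.truncn t.
have /andP[n1 n2] := truncn_itv t0.
exists (s0 + n%:R * (2 * pi / `|a|)).
  by rewrite addr_ge0// mulr_ge0// divr_ge0// ltW.
exists (k0 + (if 0 < a then n%:Z else - n%:Z)), k2; split.
  rewrite (_ : alpha1 + _ = alpha1 + s0 * a + n%:R * (2 * pi / `|a|) * a); last by ring.
  rewrite Hs0 intrD.
  case: ltP => ha; first by rewrite gtr0_norm// -pmulrn; field.
  by rewrite ler0_norm// intrN -pmulrn; field.
rewrite -Ht (_ : _ - _ = (n%:R - t) * eta); last by rewrite /eta; field.
rewrite normrM (_ : `|eta| = 2 * pi * `|b| / `|a|); last first.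
  by rewrite /eta 2!normrM normfV normr_id (ger0_norm (ltW pi0)).
apply: le_trans small; apply: ler_piMl; first by rewrite mulr_ge0// ?invr_ge0// mulr_ge0// ltW.
rewrite ler_norml; move: n2; rewrite -natr1 => n2; apply/andP; split; lra.
Qed.

Lemma good_flow1 F D : continuous F -> continuous D -> periodic F -> periodic D ->
  good_flow (flow1 F D).
Proof.
move=> cF cD pF pD; split.
- exact: measurable_flow1.
- by rewrite /flow1; cont.
- by move=> t k y; rewrite /flow1 /translate/= pF pD; congr (_, _, _); ring.
- by move=> [[? ?] ?]; rewrite /flow1/= !mul0r !addr0.
Qed.

Lemma good_flow2 F D : continuous F -> continuous D -> periodic F -> periodic D ->
  good_flow (flow2 F D).
Proof.
move=> cF cD pF pD; split.
- exact: measurable_flow2.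
- by rewrite /flow2; cont.
- by move=> t k y; rewrite /flow2 /translate/= pF pD; congr (_, _, _); ring.
- by move=> [[? ?] ?]; rewrite /flow2/= !mul0r !addr0.
Qed.

Lemma good_flow3 F D : continuous F -> continuous D -> periodic F -> periodic D ->
  good_flow (flow3 F D).
Proof.
move=> cF cD pF pD; split.
- exact: measurable_flow3.
- by rewrite /flow3; cont.
- by move=> t k y; rewrite /flow3 /translate/= pF pD; congr (_, _, _); ring.
- by move=> [[? ?] ?]; rewrite /flow3/= !mul0r !addr0.
Qed.

(** The point is the last zero to the left of [w], where periodicity provides one; everything
    between it and [w] is a nonzero. *)
Lemma zero_boundary (D : R -> R) : continuous D -> periodic D ->
  (exists z, D z = 0) -> (exists w, D w != 0) ->
  exists2 z, D z = 0 & forall del, 0 < del -> exists2 c, `|c - z| <= del & D c != 0.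
Proof.
move=> cD pD [z0 Dz0] [w Dw].
have pi0 : 0 < 2 * pi :> R by rewrite mulr_gt0// pi_gt0.
pose E := [set x | x <= w /\ D x = 0].
have Ew : ubound E w by move=> x [].
have En : E !=set0.
  pose n := Num.bound ((z0 - w) / (2 * pi)).
  exists (z0 + (- n%:Z)%:~R * (2 * pi)); split; last by rewrite pD.
  rewrite intrN -pmulrn; have [h|h] := leP 0 ((z0 - w) / (2 * pi)).
    by have := archi_boundP h; rewrite ltr_pdivrMr// -/n; lra.
  move: h; rewrite pmulr_llt0 ?invr_gt0// => h.
  have n0 : 0 <= n%:R * (2 * pi) :> R by rewrite mulr_ge0// ltW.
  by lra.
have hs : has_sup E by split=> //; exists w.
pose z := sup E.
have zw : z <= w by exact: ge_sup.
have Dz : D z = 0.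
  apply/eqP/negPn/negP => Dz0'; have nz : 0 < `|D z| by rewrite normr_gt0.
  have [del del0 H] := continuous_delta z cD (divr_gt0 nz (ltr0n _ 2)).
  have [x [xw Dx] zx] := sup_adherent del0 hs.
  have xz : x <= z by apply: ub_le_sup => //; exists w.
  have xz' : `|x - z| <= del by rewrite ler_norml; apply/andP; split; [rewrite -/z in zx|]; lra.
  by have := H x xz'; rewrite Dx sub0r normrN leNgt ltr_pdivrMr// ltr_pMr// ltr1n.
exists z => // del del0.
have zw' : z < w by rewrite lt_neqAle zw andbT; apply: contra Dw => /eqP <-; rewrite Dz.
pose c := Num.min (z + del) w.
have zc : z < c by rewrite lt_min zw' andbT ltrDl.
exists c.
  have : c <= z + del by rewrite ge_min lexx.
  by rewrite ler_norml => ?; apply/andP; split; lra.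
apply/negP => /eqP Dc.
have : c <= z by apply: ub_le_sup; [exists w|split=> //; rewrite ge_min lexx orbT].
by rewrite leNgt zc.
Qed.

(* The orbit visits, in three rounds, the places named in the proof: [alpha] where
   [flow2] moves [x3], [beta] where [flow3] moves [x1], and the level [x3 = c],
   close to the zero [z] of [D1], on which [flow1] has a small nonzero slope. *)
Lemma minorized_everywhere (e : probability R R) (F1 D1 F2 D2 F3 D3 : R -> R) :
  dominates_lebesgue e ->
  continuous F1 -> continuous D1 -> continuous F2 -> continuous D2 ->
  continuous F3 -> continuous D3 ->
  periodic F1 -> periodic D1 -> periodic F2 -> periodic D2 -> periodic F3 -> periodic D3 ->
  (forall x, locally_lipschitz_at F2 x) -> (forall x, locally_lipschitz_at D2 x) ->
  (forall x, D1 x = 0 -> F1 x != 0) -> (forall x, D2 x = 0 -> F2 x != 0) ->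
  (forall x, D3 x = 0 -> F3 x != 0) ->
  (exists x, D1 x = 0) -> (exists x, D1 x != 0) ->
  (exists x, D2 x = 0) -> (exists x, D2 x != 0) ->
  (exists x, D3 x = 0) -> (exists x, D3 x != 0) ->
  let Q G := flow_average e (flow1 F1 D1) (flow_average e (flow2 F2 D2)
    (flow_average e (flow3 F3 D3) G)) in
  exists l u : S, [/\ l.1.1 < u.1.1, l.1.2 < u.1.2 & l.2 < u.2] /\
    forall y, minorized_at l u (iter 4 Q) y.
Proof.
move=> edom cF1 cD1 cF2 cD2 cF3 cD3 pF1 pD1 pF2 pD2 pF3 pD3 lF2 lD2 nz1 nz2 nz3.
move=> zD1 wD1 [x1 D2x1] [alpha D2a] [x2 D3x2] [beta D3b] Q.
have gf1 := good_flow1 cF1 cD1 pF1 pD1.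
have gf2 := good_flow2 cF2 cD2 pF2 pD2.
have gf3 := good_flow3 cF3 cD3 pF3 pD3.
have [z Dz zb] := zero_boundary cD1 pD1 zD1 wD1.
have F1z := nz1 _ Dz; have F2x := nz2 _ D2x1; have F3x := nz3 _ D3x2.
have [l [u [c0 [lu c00 near_base]]]] :=
  base_minorization edom cF1 cD1 cF2 cD2 cF3 cD3 (lF2 x1) (lD2 x1) F1z Dz F2x F3x D3x2.
exists l, u; split => // y.
have opq fl : good_flow fl -> exists s, [/\ s = flow_average e fl,
    forall T, (forall G, admissible G -> admissible (T G)) ->
      forall G, admissible G -> admissible (s (T G)),
    forall T t w, 0 <= t -> (forall G, admissible G -> admissible (T G)) ->
      minorized_at l u T (fl t w) -> minorized_at l u (fun G => s (T G)) w &
    forall T w, (forall G, admissible G -> admissible (T G)) ->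
      minorized_at l u T w -> minorized_at l u (fun G => s (T G)) w].
  move=> gf; exists (flow_average e fl); split => //.
  - by move=> T Ta G Ga; apply: flow_average_admissible => //; exact: Ta.
  - by move=> T t w t0 Ta; exact: minorized_step.
  - by move=> T w Ta; exact: minorized_stay.
have [s1 [s1E a1 step1 stay1]] := opq _ gf1.
have [s2 [s2E a2 step2 stay2]] := opq _ gf2.
have [s3 [s3E a3 step3 stay3]] := opq _ gf3.
have [q qE] : exists q, q = Q by exists Q.
have qs : forall G, q G = s1 (s2 (s3 G)) by rewrite qE s1E s2E s3E.
have aQ : forall G, admissible G -> admissible (q G).
  by move=> G; rewrite qs; exact: (a1 _ (a2 _ (a3 id (fun _ h => h)))).
have base : \forall y \near (x1, x2, z), minorized_at l u q y.
  (* Being minorized is an open condition: a bound on a neighbourhood of a point is also a bound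
     near each of its close neighbours. *)
  have : minorized_at l u q (x1, x2, z).
    by exists c0 => //; rewrite qE; apply: filterS near_base => w H G [mG G0 _]; exact: H.
  by move=> [eps eps0 /near_join]; apply: filterS => w H; exists eps.
have [del del0 box] : exists2 del : R, 0 < del & forall w, `|w.1.1 - x1| <= del ->
    `|w.1.2 - x2| <= del -> `|w.2 - z| <= del -> minorized_at l u q w.
  move/nbhs_ballP : base => [del /= del0 H]; exists (del / 2); first by rewrite divr_gt0.
  have d2 : del / 2 < del by rewrite ltr_pdivrMr// ltr_pMr// ltr1n.
  move=> w w1 w2 w3; apply: H; split; first split; rewrite /ball/= distrC.
  - exact: le_lt_trans d2.
  - exact: le_lt_trans d2.
  - exact: le_lt_trans d2.
have nF1z : 0 < `|F1 z| by rewrite normr_gt0.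
have pi0 : 0 < pi :> R by exact: pi_gt0.
have [dF dF0 HF] := continuous_delta z cF1 (divr_gt0 nF1z (ltr0n _ 2)).
(* With [|F1 c|] at least half of [|F1 z|], this bound on [|D1 c|] makes the spacing
   [2 * pi * |D1 c| / |F1 c|] at most [del]. *)
have k0 : 0 < del * `|F1 z| / (4 * pi) by rewrite divr_gt0// mulr_gt0.
have [dD dD0 HD] := continuous_delta z cD1 k0.
have [c cz D1c] : exists2 c, `|c - z| <= Num.min del (Num.min dF dD) & D1 c != 0.
  by apply: zb; rewrite !lt_min del0 dF0 dD0.
move: cz; rewrite !le_min => /and3P[c1 c2 c3].
have F1c : `|F1 z| / 2 <= `|F1 c|.
  have := HF c c2; have := ler_distD (F1 c) (F1 z) 0; rewrite !subr0.
  by rewrite (distrC (F1 z) (F1 c)) => h1 h2; lra.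
have F1c0 : F1 c != 0 by rewrite -normr_gt0; apply: lt_le_trans F1c; rewrite divr_gt0.
have slope : 2 * pi * `|D1 c| / `|F1 c| <= del.
  rewrite ler_pdivrMr ?normr_gt0//.
  have := HD c c3; rewrite Dz subr0 ler_pdivlMr ?mulr_gt0// => h.
  have : del * (`|F1 z| / 2) <= del * `|F1 c| by rewrite ler_wpM2l// ltW.
  by lra.
pose mk := minorized_translate (l := l) (u := u).
have aA : forall G, admissible G -> admissible (s1 (s2 (s3 (q G)))).
  exact: (a1 _ (a2 _ (a3 _ aQ))).
(* The route is assembled backwards from the base point, each claim prepending operators to the
   word. On the level [c], [flow1] reaches [x1] exactly and [x2] up to [del] modulo the lattice; the
   two other flows of the round stay put. *)
have MA w : w.2 = c -> minorized_at l u (fun G => s1 (s2 (s3 (q G)))) w.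
  move=> wc; have [s s0 [k1 [k2 [h1 h2]]]] :=
    reach_mod_torus w.1.1 w.1.2 x1 x2 F1c0 D1c slope.
  apply: (step1 (fun G => s2 (s3 (q G))) s) => //; first exact: (a2 _ (a3 _ aQ)).
  apply: (stay2 (fun G => s3 (q G))); first exact: (a3 _ aQ).
  apply: stay3 => //.
  apply: (mk _ (- k1, - k2, 0)) => //; apply: box; rewrite /translate /flow1/= wc.
  - by rewrite h1 intrN mulNr addrK subrr normr0 ltW.
  - by rewrite intrN mulNr -addrA -opprD [_ + x2]addrC.
  - by rewrite mul0r addr0.
have aB : forall G, admissible G -> admissible (s3 (s1 (s2 (s3 (q G))))).
  exact: (a3 _ aA).
have MB w : D2 w.1.1 != 0 -> minorized_at l u (fun G => s2 (s3 (s1 (s2 (s3 (q G)))))) w.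
  move=> Dw; have [s s0 [k h]] := reach_mod w.2 c Dw.
  apply: (step2 (fun G => s3 (s1 (s2 (s3 (q G))))) s) => //.
  apply: (stay3 (fun G => s1 (s2 (s3 (q G))))) => //.
  apply: (mk _ (0, 0, - k)) => //.
  by apply: MA; rewrite /translate /flow2/= h intrN mulNr addrK.
have aC : forall G, admissible G -> admissible (s1 (s2 (s3 (s1 (s2 (s3 (q G))))))).
  exact: (a1 _ (a2 _ aB)).
have MC w : D2 w.1.1 != 0 -> minorized_at l u (fun G => s1 (s2 (s3 (s1 (s2 (s3 (q G))))))) w.
  move=> Dw; apply: (stay1 (fun G => s2 (s3 (s1 (s2 (s3 (q G))))))); last exact: MB.
  exact: (a2 _ aB).
have aE : forall G, admissible G -> admissible (s3 (s1 (s2 (s3 (s1 (s2 (s3 (q G)))))))).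
  exact: (a3 _ aC).
have ME w : D3 w.1.2 != 0 ->
    minorized_at l u (fun G => s3 (s1 (s2 (s3 (s1 (s2 (s3 (q G)))))))) w.
  move=> Dw; have [s s0 [k h]] := reach_mod w.1.1 alpha Dw.
  apply: (step3 (fun G => s1 (s2 (s3 (s1 (s2 (s3 (q G))))))) s) => //.
  by apply: MC; rewrite /flow3/= h pD2.
have MF w : F2 w.1.1 != 0 ->
    minorized_at l u (fun G => s2 (s3 (s1 (s2 (s3 (s1 (s2 (s3 (q G))))))))) w.
  move=> Fw; have [s s0 [k h]] := reach_mod w.1.2 beta Fw.
  apply: (step2 (fun G => s3 (s1 (s2 (s3 (s1 (s2 (s3 (q G)))))))) s) => //.
  by apply: ME; rewrite /flow2/= h pD3.
have -> : iter 4 Q = fun G => s1 (s2 (s3 (s1 (s2 (s3 (s1 (s2 (s3 (q G))))))))).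
  by apply/funext => G; rewrite -!qs qE.
apply: (stay1 (fun G => s2 (s3 (s1 (s2 (s3 (s1 (s2 (s3 (q G)))))))))); first exact: (a2 _ aE).
(* If [F2] does not vanish, [flow2] can bring [x2] to [beta]. Otherwise [D2] is nonzero by [nz2], so
   [x1] already suits the move of [x3] to the level [c], and the detour through [beta] and [alpha]
   is replaced by staying. *)
have [F0|F0] := eqVneq (F2 y.1.1) 0; last exact: MF.
have D20 : D2 y.1.1 != 0 by apply/eqP => D0; have := nz2 _ D0; rewrite F0 eqxx.
apply: (stay2 (fun G => s3 (s1 (s2 (s3 (s1 (s2 (s3 (q G))))))))) => //.
by apply: (stay3 (fun G => s1 (s2 (s3 (s1 (s2 (s3 (q G)))))))) => //; exact: MC.
Qed.

(** A smaller [eps] gives a weaker bound, so compactness of a fundamental cube can be used along the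
    filter of [eps] tending to [0] from the right; periodicity extends the bound to the whole
    space. *)
Lemma minorized_uniform (l u : S) (T : (S -> \bar R) -> S -> \bar R) :
  (forall G, admissible G -> admissible (T G)) -> (forall y, minorized_at l u T y) ->
  exists2 eps : R, 0 < eps & forall y G, admissible G ->
    (eps%:E * box_integral l u G <= T G y)%E.
Proof.
move=> Tadm H; have pi0 : 0 < 2 * pi :> R by rewrite mulr_gt0// pi_gt0.
pose I := `[(0 : R), 2 * pi]%classic.
have cI : compact (I `*` I `*` I).
  by do 2 (apply: compact_setX; last exact: segment_compact); exact: segment_compact.
have /compact_near_coveringP/(_ _ (0 : R)^'+
  (fun eps y => forall G, admissible G -> (eps%:E * box_integral l u G <= T G y)%E) _) := cI.
have near_cov : forall x, (I `*` I `*` I) x -> \forall x' \near x & eps \near (0 : R)^'+,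
    forall G, admissible G -> (eps%:E * box_integral l u G <= T G x')%E.
  move=> x _; have [eps eps0 near_x] := H x.
  exists ([set x' | forall G, admissible G -> (eps%:E * box_integral l u G <= T G x')%E],
    [set eps' | eps' <= eps]) => /=.
    by split => //; apply: nbhs_right_le.
  move=> [x' eps'] /= [Hx' e'e] G Ga; apply: le_trans (Hx' G Ga).
  by rewrite lee_wpmul2r ?lee_fin//; apply: box_integral_ge0; have [] := Ga.
move=> /(_ near_cov) near0.
have [eps [eps0 Heps]] : exists eps : R, 0 < eps /\ (I `*` I `*` I `<=` fun y =>
    forall G, admissible G -> (eps%:E * box_integral l u G <= T G y)%E).
  near (0 : R)^'+ => eps; exists eps; split; near: eps => //.
  exact: nbhs_right_gt.
exists eps => // y G Ga.
have wrap (x : R) : exists k : int, I (x + k%:~R * (2 * pi)).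
  exists (- Num.floor (x / (2 * pi))); rewrite /I/= in_itv/= intrN mulNr subr_ge0 lerBlDr.
  have /andP[h1 h2] := floor_itv (x / (2 * pi)).
  rewrite -ler_pdivlMr// h1/=; move: h2; rewrite intrD ltr_pdivrMr// => h2.
  by apply: ltW; apply: (lt_le_trans h2); rewrite mulrDl mul1r addrC.
have [k1 h1] := wrap y.1.1; have [k2 h2] := wrap y.1.2; have [k3 h3] := wrap y.2.
have [_ _ Tk] := Tadm _ Ga; rewrite -(Tk (k1, k2, k3)).
by apply: Heps.
Unshelve. all: by end_near. Qed.

End Reachability.

(** * Termwise differentiation of power series *)

Section RealAnalytic.
Context {R : realType}.
Implicit Types (a : nat -> R) (g : R -> R).

(** The convex function [x ^+ i.+1] lies above its tangent at [q]. This absorbs the factor of a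
    differentiated series into a slightly larger ratio [p]. *)
Lemma natmul_expr_le (p q : R) (i : nat) : 0 <= q <= p ->
  i.+1%:R * q ^+ i * (p - q) <= p ^+ i.+1 - q ^+ i.+1.
Proof.
move=> /andP[q0 qp]; have p0 : 0 <= p by exact: le_trans qp.
elim: i => [|i IH]; first by rewrite mul1r expr0 mul1r !expr1.
have h1 : q ^+ i.+1 <= p ^+ i.+1 by rewrite lerXn2r.
have h2 := ler_wpM2l q0 IH.
have h3 : 0 <= (p - q) * (p ^+ i.+1 - q ^+ i.+1) by rewrite mulr_ge0// subr_ge0.
rewrite (_ : i.+2%:R = i.+1%:R + 1); last by rewrite natr1.
rewrite mulrDl mulrDl mul1r [p ^+ i.+2]exprS [q ^+ i.+2]exprS.
have -> : i.+1%:R * q ^+ i.+1 * (p - q) = q * (i.+1%:R * q ^+ i * (p - q)).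
  by rewrite exprS; ring.
by move: h2 h3; set u := p ^+ i.+1; set v := q ^+ i.+1; set w := i.+1%:R * _ * _; lra.
Qed.

(** The terms [a n * x ^+ n] are bounded. With [q = |z| / |x|] and [p] halfway between [q] and 1,
    the factor [n.+1%:R * q ^+ n] is at most [p ^+ n.+1 / (p - q)], which gives a geometric
    majorant. *)
Lemma is_cvg_pseries_diffs a (x z : R) : cvgn (pseries a x) -> `|z| < `|x| ->
  cvgn (pseries (pseries_diffs a) z).
Proof.
move=> Cx zx; have [K [Kreal Kf]] := cvg_series_bounded Cx.
have {Kf} aK n : `|a n * x ^+ n| <= `|K| + 1.
  by apply: Kf => //; rewrite (le_lt_trans (ler_norm K))// ltrDl.
have x0 : 0 < `|x| by exact: le_lt_trans zx.
pose q := `|z| / `|x|.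
have q0 : 0 <= q by rewrite divr_ge0.
have q1 : q < 1 by rewrite ltr_pdivrMr// mul1r.
have [p [pq p1 p0]] : exists p, [/\ 0 < p - q, p < 1 & 0 <= p].
  by exists ((q + 1) / 2); split; lra.
apply: normed_cvg.
apply: (@series_le_cvg _ _ (geometric ((`|K| + 1) / `|x| * (p / (p - q))) p)) => //.
- by move=> n; exact: normr_ge0.
- move=> n; apply: mulr_ge0; last exact: exprn_ge0.
  by apply: mulr_ge0; [rewrite divr_ge0// addr_ge0|rewrite divr_ge0// ltW].
- move=> n; rewrite /pseries_diffs/=.
  have -> : n.+1%:R * a n.+1 * z ^+ n =
      (a n.+1 * x ^+ n.+1) / x * (n.+1%:R * (z / x) ^+ n).
    by rewrite exprMn exprS exprVn; field; rewrite expf_neq0 -normr_gt0.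
  rewrite normrM normrM normfV -!mulrA; apply: ler_pM => //.
  rewrite ler_wpM2l ?invr_ge0//.
  rewrite normrM normr_nat normrX normrM normfV -/q mulrCA.
  rewrite ler_pdivlMl// mulrC -exprS.
  apply: le_trans (natmul_expr_le n _) _; first by rewrite q0/= -subr_ge0 ltW.
  by rewrite lerBlDr lerDl exprn_ge0.
by apply: is_cvg_geometric_series; rewrite ger0_norm.
Qed.

(** The derivative is again analytic, so the lemma can be iterated; applied to [g], [g'] and [g''],
    it yields local Lipschitz bounds for [g] and [g']. *)
Lemma real_analytic_derive g : real_analytic g ->
  (forall x, derivable g x 1) /\ real_analytic (derive1 g).
Proof.
move=> gan.
have key x0 : exists a, exists2 r : R, 0 < r & forall x, `|x - x0| < r ->
    is_derive x (1 : R) g (limn (pseries (pseries_diffs a) (x - x0))) /\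
    cvgn (pseries (pseries_diffs a) (x - x0)).
  have [a /nbhs_ballP[r /= r0 Hr]] := gan x0.
  have cvga y : `|y| < r -> pseries a y @ \oo --> g (y + x0).
    move=> yr; have /= := Hr (y + x0); rewrite addrK; apply.
    by rewrite /ball/= opprD addrCA subrr addr0 normrN.
  exists a, r => // x xr.
  (* Points strictly between [|x - x0|] and [r]. Each differentiation loses some radius, and
     differentiating the sum requires the series and its first two formal derivatives to converge at
     [k 1], hence the start from [k 3]. *)
  pose k (j : R) := `|x - x0| + j * ((r - `|x - x0|) / 4).
  have d0 : 0 < (r - `|x - x0|) / 4 by rewrite divr_gt0// subr_gt0.
  have kE (i j : R) : 0 <= i -> i < j -> `|k i| < `|k j|.
    move=> i0 ij; have i0' : 0 <= k i by rewrite addr_ge0// mulr_ge0// ltW.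
    have kij : k i < k j by rewrite ltrD2l ltr_pM2r.
    by rewrite !ger0_norm// (le_trans i0')// ltW.
  have k0 : `|x - x0| = `|k 0| by rewrite /k mul0r addr0 normr_id.
  have c3 : cvgn (pseries a (k 3)).
    apply/cvg_ex; exists (g (k 3 + x0)); apply: cvga.
    rewrite ger0_norm; last by rewrite /k addr_ge0// mulr_ge0// ltW.
    by rewrite /k; lra.
  have l23 := kE 2 3 (ler0n _ 2) ltac:(lra).
  have l12 := kE 1 2 (ler0n _ 1) ltac:(lra).
  have l01 := kE 0 1 (lexx 0) ltr01.
  have c2 := is_cvg_pseries_diffs c3 l23.
  have c1 := is_cvg_pseries_diffs c2 l12.
  have c1' := is_cvg_pseries_diffs c3 (lt_trans l12 l23).
  have c1'' := is_cvg_pseries_inside c3 (lt_trans l12 l23).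
  rewrite -k0 in l01.
  split; last exact: is_cvg_pseries_inside c1' l01.
  have der := pseries_snd_diffs c1'' c1' c1 l01.
  have der' : is_derive x (1 : R) ((fun y => limn (pseries a y)) \o (fun y => y - x0))
      (limn (pseries (pseries_diffs a) (x - x0))).
    have sh : is_derive x (1 : R) (fun y => y - x0) 1 by exact: is_derive_shift.
    have := @is_derive1_comp R (fun y => limn (pseries a y)) (fun y => y - x0) x _ _ der sh.
    by rewrite mulr1.
  apply: near_eq_is_derive der'; near=> y => /=.
  apply/cvg_lim; first exact: norm_hausdorff.
  rewrite -[in X in _ --> X](subrK x0 y); apply: cvga; near: y.
  have : nbhs x (ball x (r - `|x - x0|)) by apply: nbhsx_ballx; rewrite subr_gt0.
  apply: filterS => y; rewrite /ball/= distrC => yx.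
  by have := ler_distD x y x0; lra.
split=> [x|x0].
  have [a [r r0 H]] := key x; have xx : `|x - x| < r by rewrite subrr normr0.
  by have [dx _] := H x xx; exact: ex_derive.
have [a [r r0 H]] := key x0; exists (pseries_diffs a).
apply/nbhs_ballP; exists r => //= x; rewrite /ball/= distrC => xr.
have [dx cx] := H x xr.
by rewrite derive1E (@derive_val _ _ _ _ _ _ _ dx).
Unshelve. all: by end_near. Qed.

Lemma derivable_locally_lipschitz g : (forall x, derivable g x 1) ->
  continuous (derive1 g) -> forall x, locally_lipschitz_at g x.
Proof.
move=> dg cdg x; have [del del0 H] := continuous_delta x cdg ltr01.
exists del => //; exists (`|derive1 g x| + 1); first by rewrite addr_ge0.
have cg : continuous g.
  by move=> y; apply: differentiable_continuous; apply/derivable1_diffP.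
have lip u v : u <= v -> `|u - x| <= del -> `|v - x| <= del ->
    `|g u - g v| <= (`|derive1 g x| + 1) * `|u - v|.
  move=> uv ux vx.
  have [c cuv gE] := @MVT_segment R g (derive1 g) u v uv
    (fun y _ => @DeriveDef _ _ _ _ _ _ _ (dg y) (esym (derive1E g y))) (continuous_subspaceT cg).
  rewrite distrC gE normrM (distrC v) ler_wpM2r//.
  move: cuv; rewrite in_itv/= => /andP[c1 c2].
  have cx : `|c - x| <= del.
    by move: ux vx; rewrite !ler_norml => /andP[? ?] /andP[? ?]; apply/andP; split; lra.
  by have := norm_add_le (H c cx) (lexx `|derive1 g x|); rewrite subrK addrC.
move=> u v ux vx; have [uv|/ltW vu] := leP u v; first exact: lip.
by rewrite distrC (distrC u); exact: lip.
Qed.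

End RealAnalytic.

(** * Functions on the circle and their periodic lifts *)

Section Circle.
Context {R : realType}.
Implicit Types (f : circle R -> R).

Lemma circle_proj_eq (x y : R) :
  circle_proj x = circle_proj y <-> exists k : int, x - y = k%:~R * (2 * pi).
Proof.
by split=> [/eqquotP/asboolP|H]; last exact/eqquotP/asboolP.
Qed.

Lemma circle_proj_translate (x : R) (k : int) : circle_proj (x + k%:~R * (2 * pi)) = circle_proj x.
Proof. by apply/circle_proj_eq; exists k; rewrite addrAC subrr add0r. Qed.

Lemma circle_lift_periodic f : periodic (circle_lift f).
Proof. by move=> x k; rewrite /circle_lift/= circle_proj_translate. Qed.

Lemma derive1_periodic (F : R -> R) : periodic F -> periodic (derive1 F).
Proof.
move=> pF x k; rewrite /derive1 pF.
by under eq_fun do rewrite addrA pF.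
Qed.

Lemma circle_derivE f x : circle_deriv f (circle_proj x) = derive1 (circle_lift f) x.
Proof.
rewrite /circle_deriv.
have : circle_proj (repr (circle_proj x)) = circle_proj x by exact: reprK.
move=> /circle_proj_eq[k /eqP]; rewrite subr_eq addrC => /eqP ->.
by rewrite derive1_periodic//; exact: circle_lift_periodic.
Qed.

Lemma derive1_root (F : R -> R) : periodic F -> (forall x, derivable F x 1) ->
  exists x, derive1 F x = 0.
Proof.
move=> pF dF; have pi0 : 0 < 2 * pi :> R by rewrite mulr_gt0// pi_gt0.
have cF : continuous F by move=> y; apply: differentiable_continuous; apply/derivable1_diffP.
have [c _ /eqP] := @MVT_segment R F (derive1 F) 0 (2 * pi) (ltW pi0)
    (fun y _ => @DeriveDef _ _ _ _ _ _ _ (dF y) (esym (derive1E F y))) (continuous_subspaceT cF).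
have F2 : F (2 * pi) = F 0 by have := pF 0 1; rewrite add0r mul1r.
by rewrite F2 subrr subr0 eq_sym mulf_eq0 (gt_eqF pi0) orbF => /eqP; exists c.
Qed.

Lemma derive1_nonroot (F : R -> R) : (forall x, derivable F x 1) ->
  (exists x y, F x <> F y) -> exists x, derive1 F x != 0.
Proof.
move=> dF [x [y Fxy]]; apply: contrapT => H.
have D0 z : derive1 F z = 0 by apply/eqP/negPn/negP => D0; apply: H; exists z.
have cF : continuous F by move=> z; apply: differentiable_continuous; apply/derivable1_diffP.
have cst u v : u <= v -> F u = F v.
  move=> uv; have [c _ /eqP] := @MVT_segment R F (derive1 F) u v uv
    (fun y _ => @DeriveDef _ _ _ _ _ _ _ (dF y) (esym (derive1E F y))) (continuous_subspaceT cF).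
  by rewrite D0 mul0r subr_eq0 => /eqP.
by have [xy|/ltW xy] := leP x y; apply: Fxy; [exact: cst|exact/esym/cst].
Qed.

End Circle.

(** * Identification of the flows on the torus *)

Section ExplicitFlows.
Context {R : realType}.
Notation S := (R * R * R)%type.

Lemma is_derive_fst (V W : normedModType R) (c : R -> V * W) (t : R) v :
  is_derive t (1 : R) c v -> is_derive t (1 : R) (fun s => (c s).1) v.1.
Proof.
move=> [dc cv]; have cvg1 : h^-1 *: ((c (h *: 1 + t)).1 - (c t).1) @[h --> 0^'] --> v.1.
  have : h^-1 *: (c (h *: 1 + t) - c t) @[h --> 0^'] --> v by rewrite -cv.
  move=> H; apply: (@cvg_comp _ _ _ (fun h => h^-1 *: (c (h *: 1 + t) - c t)) fst _ _ _ H).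
  exact: cvg_fst.
by apply: DeriveDef; [apply/cvg_ex; exists v.1|apply/cvg_lim; first exact: norm_hausdorff].
Qed.

Lemma is_derive_snd (V W : normedModType R) (c : R -> V * W) (t : R) v :
  is_derive t (1 : R) c v -> is_derive t (1 : R) (fun s => (c s).2) v.2.
Proof.
move=> [dc cv]; have cvg1 : h^-1 *: ((c (h *: 1 + t)).2 - (c t).2) @[h --> 0^'] --> v.2.
  have : h^-1 *: (c (h *: 1 + t) - c t) @[h --> 0^'] --> v by rewrite -cv.
  move=> H; apply: (@cvg_comp _ _ _ (fun h => h^-1 *: (c (h *: 1 + t) - c t)) snd _ _ _ H).
  exact: cvg_snd.
by apply: DeriveDef; [apply/cvg_ex; exists v.2|apply/cvg_lim; first exact: norm_hausdorff].
Qed.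

Lemma is_derive_affine (f : R -> R) (a : R) : (forall t, is_derive t (1 : R) f a) ->
  forall t, f t = f 0 + t * a.
Proof.
move=> df t; pose g s := f s - s * a.
have dg s : is_derive s (1 : R) g 0.
  have dl : is_derive s (1 : R) (fun s => s * a) a.
    rewrite (_ : (fun s => s * a) = a \*: id); last by apply/funext => r /=; rewrite mulrC.
    by rewrite -[X in is_derive _ _ _ X]mulr1; exact: is_deriveZ.
  by rewrite -(subrr a); exact: is_deriveB.
have := @is_derive_0_is_cst R g t 0 dg; rewrite /g mul0r subr0 => <-.
by rewrite subrK.
Qed.

Lemma torus_proj_eq (a b : S) : torus_proj a = torus_proj b -> exists k, a = translate k b.
Proof.
move=> [/circle_proj_eq[k1 h1] /circle_proj_eq[k2 h2] /circle_proj_eq[k3 h3]].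
exists (k1, k2, k3); rewrite /translate/= -h1 -h2 -h3 ![_ + (_ - _)]addrC !subrK.
by case: a h1 h2 h3 => -[].
Qed.

Lemma torus_proj_translate k (y : S) : torus_proj (translate k y) = torus_proj y.
Proof. by rewrite /torus_proj/= !circle_proj_translate. Qed.

(** The lift of a trajectory starts at some translate of [y], not necessarily at [y]. Equivariance
    of [fl] carries the translation to time [t], where the projection forgets it. *)
Lemma flow_unique (X : torus R -> S) (phi : R -> torus R -> torus R) (fl : R -> S -> S) :
  is_flow X phi -> (forall t k y, fl t (translate k y) = translate k (fl t y)) ->
  (forall c : R -> S, (forall t, is_derive t (1 : R) c (X (torus_proj (c t)))) ->
    forall t, c t = fl t (c 0)) ->
  forall t y, phi t (torus_proj y) = torus_proj (fl t y).
Proof.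
move=> Xphi flk Hfl t y; have [phi0 [c cphi dc]] := Xphi (torus_proj y).
have [k c0] : exists k, c 0 = translate k y by apply: torus_proj_eq; rewrite cphi.
have ct : c t = fl t (c 0) by apply: Hfl => s; rewrite cphi.
by rewrite -cphi ct c0 flk torus_proj_translate.
Qed.

Section Vectorfields.
Variable f : circle R -> R.
Let F := circle_lift f.
Let D := derive1 F.
Let pF : periodic F. Proof. exact: circle_lift_periodic. Qed.
Let pD : periodic D. Proof. exact: derive1_periodic. Qed.

Lemma flow1_unique phi : is_flow (X1 f) phi ->
  forall t y, phi t (torus_proj y) = torus_proj (flow1 F D t y).
Proof.
move=> Xphi; apply: flow_unique Xphi _ _.
  by move=> t k y; rewrite /flow1 /translate/= pF pD; congr (_, _, _); ring.
move=> c dc t.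
have d1 s := is_derive_fst (is_derive_fst (dc s)).
have d2 s := is_derive_snd (is_derive_fst (dc s)).
have d3 s := is_derive_snd (dc s).
have c3 s : (c s).2 = (c 0).2.
  by rewrite (is_derive_affine (f := fun s => (c s).2) (a := 0) d3) mulr0 addr0.
have c1 : (c t).1.1 = (c 0).1.1 + t * F (c 0).2.
  apply: (is_derive_affine (f := fun s => (c s).1.1)) => s.
  by have := d1 s; rewrite /= c3.
have c2 : (c t).1.2 = (c 0).1.2 + t * D (c 0).2.
  apply: (is_derive_affine (f := fun s => (c s).1.2)) => s.
  by have := d2 s; rewrite /= c3 circle_derivE.
by rewrite /flow1 -c1 -c2 -(c3 t); case: (c t) => -[].
Qed.

Lemma flow2_unique phi : is_flow (X2 f) phi ->
  forall t y, phi t (torus_proj y) = torus_proj (flow2 F D t y).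
Proof.
move=> Xphi; apply: flow_unique Xphi _ _.
  by move=> t k y; rewrite /flow2 /translate/= pF pD; congr (_, _, _); ring.
move=> c dc t.
have d1 s := is_derive_fst (is_derive_fst (dc s)).
have d2 s := is_derive_snd (is_derive_fst (dc s)).
have d3 s := is_derive_snd (dc s).
have c1 s : (c s).1.1 = (c 0).1.1.
  by rewrite (is_derive_affine (f := fun s => (c s).1.1) (a := 0) d1) mulr0 addr0.
have c2 : (c t).1.2 = (c 0).1.2 + t * F (c 0).1.1.
  apply: (is_derive_affine (f := fun s => (c s).1.2)) => s.
  by have := d2 s; rewrite /= c1.
have c3 : (c t).2 = (c 0).2 + t * D (c 0).1.1.
  apply: (is_derive_affine (f := fun s => (c s).2)) => s.
  by have := d3 s; rewrite /= c1 circle_derivE.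
by rewrite /flow2 -c2 -c3 -(c1 t); case: (c t) => -[].
Qed.

Lemma flow3_unique phi : is_flow (X3 f) phi ->
  forall t y, phi t (torus_proj y) = torus_proj (flow3 F D t y).
Proof.
move=> Xphi; apply: flow_unique Xphi _ _.
  by move=> t k y; rewrite /flow3 /translate/= pF pD; congr (_, _, _); ring.
move=> c dc t.
have d1 s := is_derive_fst (is_derive_fst (dc s)).
have d2 s := is_derive_snd (is_derive_fst (dc s)).
have d3 s := is_derive_snd (dc s).
have c2 s : (c s).1.2 = (c 0).1.2.
  by rewrite (is_derive_affine (f := fun s => (c s).1.2) (a := 0) d2) mulr0 addr0.
have c1 : (c t).1.1 = (c 0).1.1 + t * D (c 0).1.2.
  apply: (is_derive_affine (f := fun s => (c s).1.1)) => s.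
  by have := d1 s; rewrite /= c2 circle_derivE.
have c3 : (c t).2 = (c 0).2 + t * F (c 0).1.2.
  apply: (is_derive_affine (f := fun s => (c s).2)) => s.
  by have := d3 s; rewrite /= c2.
by rewrite /flow3 -c1 -c3 -(c2 t); case: (c t) => -[].
Qed.

End Vectorfields.
End ExplicitFlows.

(** * Borel structure of the torus *)

Section TorusMeasurability.
Context {R : realType}.
Notation S := (R * R * R)%type.

(** The sigma-algebra here is the product one, so an open set is written as a countable union of
    cubes with rational centres and radii [1 / (n + 1)]. *)
Lemma open_measurable_R3 (U : set S) : open U -> measurable U.
Proof.
move=> oU.
pose B (q1 q2 q3 : rat) (n : nat) : set S :=
  (ball (ratr q1 : R) n.+1%:R^-1 `*` ball (ratr q2 : R) n.+1%:R^-1) `*` ball (ratr q3 : R) n.+1%:R^-1.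
have mB q1 q2 q3 n : measurable (B q1 q2 q3 n).
  by do 2 (apply: measurableX; last exact: measurable_ball); exact: measurable_ball.
have -> : U = \bigcup_q1 \bigcup_q2 \bigcup_q3 \bigcup_n
    (if `[< B q1 q2 q3 n `<=` U >] then B q1 q2 q3 n else set0).
  apply/seteqP; split; last first.
    move=> x [q1 _ [q2 _ [q3 _ [n _]]]]; case: ifPn => // /asboolP; exact.
  move=> [[x1 x2] x3] Ux.
  have /nbhs_ballP[r /= r0 rU] : nbhs (x1, x2, x3) U by exact: open_nbhs_nbhs.
  have [n Hn] : exists n, n.+1%:R^-1 < r / 2.
    have r2 : 0 < r / 2 by rewrite divr_gt0.
    by have [N _ /(_ N (leqnn N))] := near_infty_natSinv_lt (PosNum r2); exists N.
  have n0 : 0 < n.+1%:R^-1 :> R by rewrite invr_gt0.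
  have rat_near (x : R) : exists q, `|ratr q - x| < n.+1%:R^-1.
    have lt : x - n.+1%:R^-1 < x + n.+1%:R^-1 by rewrite ltrBlDr -addrA ltrDl addr_gt0.
    by have [q] := rat_in_itvoo lt; rewrite in_itv/= => h; exists q; rewrite ltr_distl.
  have [[q1 h1] [q2 h2] [q3 h3]] := And3 (rat_near x1) (rat_near x2) (rat_near x3).
  exists q1 => //; exists q2 => //; exists q3 => //; exists n => //.
  have BU : B q1 q2 q3 n `<=` U.
    have tri (q : rat) (x y : R) : `|ratr q - x| < n.+1%:R^-1 -> `|ratr q - y| < n.+1%:R^-1 ->
        `|x - y| < r.
      move=> hx hy; have := ler_distD (ratr q) x y; rewrite (distrC x (ratr q)).
      by move: hx hy Hn; move: (n.+1%:R^-1) => e; lra.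
    move=> [[y1 y2] y3] [[/= b1 b2] b3]; apply: rU; split; first split.
    - exact: tri h1 b1.
    - exact: tri h2 b2.
    - exact: tri h3 b3.
  by case: ifPn => [_|/asboolP//]; split; first split.
do 3 (apply: bigcupT_measurable_rat => ?); apply: bigcupT_measurable => n.
by case: ifP.
Qed.

Lemma torus_proj_continuous : continuous (@torus_proj R).
Proof.
have cp : continuous (@circle_proj R) by exact: pi_continuous.
apply: continuous_pair; first apply: continuous_pair.
- by apply: continuous_comp_fun => //; apply: continuous_fst_comp; exact: continuous_fst_comp continuous_idf.
- by apply: continuous_comp_fun => //; apply: continuous_snd_comp; exact: continuous_fst_comp continuous_idf.
- by apply: continuous_comp_fun => //; exact: continuous_snd_comp continuous_idf.
Qed.

Lemma measurable_torus_proj : measurable_fun setT (@torus_proj R : S -> borel_torus R).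
Proof.
apply: (@measurability _ _ _ (borel_torus R) setT _ (@open (torus R))) => //.
move=> _ [U oU <-]; rewrite setTI; apply: open_measurable_R3.
by move/continuousP : torus_proj_continuous; exact.
Qed.

Definition wrap (x : R) : R := x - (Num.floor (x / (2 * pi)))%:~R * (2 * pi).

(** A right inverse of the projection that is Borel: [repr] alone is an arbitrary choice, and [wrap]
    removes the dependence on it. *)
Definition circle_section (u : circle R) : R := wrap (repr u).

Let pi0 : 0 < 2 * pi :> R.
Proof. by rewrite mulr_gt0// pi_gt0. Qed.

Lemma wrap_periodic : periodic wrap.
Proof.
move=> x k; rewrite /wrap.
have -> : (x + k%:~R * (2 * pi)) / (2 * pi) = x / (2 * pi) + k%:~R.
  by rewrite mulrDl mulfK// gt_eqF.
rewrite floorDrz ?intr_int//.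
by rewrite intrKfloor intrD mulrDl; ring.
Qed.

Lemma circle_sectionE (x : R) : circle_section (circle_proj x) = wrap x.
Proof.
rewrite /circle_section.
have : circle_proj (repr (circle_proj x)) = circle_proj x by exact: reprK.
by move=> /circle_proj_eq[k /eqP]; rewrite subr_eq addrC => /eqP ->; rewrite wrap_periodic.
Qed.

Lemma circle_sectionK (u : circle R) : circle_proj (circle_section u) = u.
Proof.
rewrite -[RHS]reprK; apply/circle_proj_eq.
exists (- Num.floor (repr u / (2 * pi))); rewrite /circle_section /wrap intrN; ring.
Qed.

Lemma wrap_itv (x : R) : 0 <= wrap x < 2 * pi.
Proof.
have /andP[h1 h2] := floor_itv (x / (2 * pi)).
rewrite /wrap subr_ge0 -ler_pdivlMr// h1/= ltrBlDl.
by move: h2; rewrite intrD ltr_pdivrMr// mulrDl mul1r.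
Qed.

Lemma measurable_circle_section :
  measurable_fun setT (circle_section : g_sigma_algebraType (@open (circle R)) -> R).
Proof.
apply: (measurability _ (RGenOInfty.measurableE R)) => //.
move=> _ [_ [a ->] <-]; rewrite setTI; apply: sub_sigma_algebra.
have [a0|a0] := ltP a 0.
  rewrite (_ : _ @^-1` _ = setT); first exact: openT.
  apply/seteqP; split => // u _ /=; rewrite in_itv/= andbT (lt_le_trans a0)//.
  by rewrite /circle_section; have /andP[] := wrap_itv (repr u).
rewrite /open/= /quotient_open.
(* The section is discontinuous at the class of 0 but lower semicontinuous: for nonnegative [a] its
   superlevel set lifts to a union of open intervals. *)
rewrite (_ : _ @^-1` _ = \bigcup_(k : int) `]a + k%:~R * (2 * pi), 2 * pi + k%:~R * (2 * pi)[%classic).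
  by apply: bigcup_open => k _; exact: interval_open.
apply/seteqP; split => x /=; rewrite -/(circle_proj x) in_itv/= andbT circle_sectionE.
  move=> ax; exists (Num.floor (x / (2 * pi))) => //=; rewrite in_itv/=.
  by have /andP[_] := wrap_itv x; move: ax; rewrite /wrap; lra.
move=> [k _]; rewrite /= in_itv/= => /andP[h1 h2].
have -> : wrap x = x - k%:~R * (2 * pi); last by lra.
rewrite /wrap; suff -> : Num.floor (x / (2 * pi)) = k by [].
apply: floor_def; rewrite ler_pdivlMr// ltr_pdivrMr// intrD mulrDl mul1r; apply/andP; split; lra.
Qed.

Definition torus_section (x : torus R) : S :=
  (circle_section x.1.1, circle_section x.1.2, circle_section x.2).

Lemma torus_sectionK x : torus_proj (torus_section x) = x.
Proof. by case: x => [[u v] w]; rewrite /torus_proj/= !circle_sectionK. Qed.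

Lemma measurable_torus_section :
  measurable_fun setT (torus_section : borel_torus R -> S).
Proof.
have mc (p : torus R -> circle R) : continuous p ->
    measurable_fun setT (circle_section \o p : borel_torus R -> R).
  move=> cp; apply: (measurableT_comp measurable_circle_section).
  apply: (@measurability _ _ _ (g_sigma_algebraType (@open (circle R))) setT _ (@open (circle R))) => //.
  move=> _ [U oU <-]; rewrite setTI; apply: sub_sigma_algebra.
  by move/continuousP : cp; exact.
apply/measurable_fun_pair; first apply/measurable_fun_pair.
- by apply: (mc (fun x => x.1.1)); apply: continuous_fst_comp; exact: continuous_fst_comp continuous_idf.
- by apply: (mc (fun x => x.1.2)); apply: continuous_snd_comp; exact: continuous_fst_comp continuous_idf.
- by apply: (mc (fun x => x.2)); exact: continuous_snd_comp continuous_idf.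
Qed.

(** Measurability on the torus can be tested on the lift, since [g] is recovered from it by
    composing with the Borel section. *)
Lemma measurable_torus_lift (g : borel_torus R -> R) :
  measurable_fun setT (fun y : S => g (torus_proj y)) -> measurable_fun setT g.
Proof.
move=> mg; rewrite (_ : g = (fun y : S => g (torus_proj y)) \o torus_section).
  exact: measurableT_comp measurable_torus_section.
by apply/funext => x /=; rewrite torus_sectionK.
Qed.

End TorusMeasurability.

(** * Law of the switching times *)

Section ExponentialLaw.
Context {R : realType}.
Local Open Scope ereal_scope.

(** The constant is the value of the decreasing density at the right end [T]. *)
Lemma exponential_dominates_lebesgue (e : {measure set R -> \bar R}) (rate : R) : (0 < rate)%R ->
  (forall A, measurable A -> e A = exponential_prob rate A) -> dominates_lebesgue e.
Proof.
move=> r0 eE T T0; exists (rate * expR (- rate * T))%R; first by rewrite mulr_gt0// expR_gt0.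
move=> E mE ET; rewrite eE// /exponential_prob.
have -> : (rate * expR (- rate * T))%:E * lebR E =
    \int[lebesgue_measure]_(x in E) cst (rate * expR (- rate * T))%:E x.
  by rewrite integral_cst.
apply: ge0_le_integral => //.
- by move=> x _; rewrite lee_fin mulr_ge0 ?expR_ge0// ltW.
- by apply/measurable_EFinP; apply: measurable_funTS; exact: measurable_exponential_pdf.
move=> x /ET; rewrite /= in_itv/= => /andP[x0 xT].
rewrite lee_fin exponential_pdfE// ler_wpM2l ?(ltW r0)// ler_expR.
by rewrite !mulNr lerN2 ler_wpM2l// ltW.
Qed.

End ExponentialLaw.

Section JointLaw.
Context {d : measure_display} {Omega : measurableType d} {R : realType}.
Variable Pr : probability Omega R.
Local Open Scope ereal_scope.

Lemma product_mscale (e1 e2 : probability R R) (k : {nonneg R}) (X : set (R * R)) : measurable X ->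
  (e1 \x mscale k e2) X = k%:num%:E * (e1 \x e2) X.
Proof.
move=> mX; rewrite /product_measure1/= -ge0_integralZl_EFin//.
exact: measurable_fun_xsection.
Qed.

Lemma joint_law3 (X0 X1 X2 : {RV Pr >-> R}) (e : probability R R) :
  (forall A B C : set R, measurable A -> measurable B -> measurable C ->
    Pr (X0 @^-1` A `&` X1 @^-1` B `&` X2 @^-1` C) = e A * e B * e C) ->
  forall f : R * R * R -> \bar R, measurable_fun setT f -> (forall z, 0 <= f z) ->
  \int[Pr]_w f (X0 w, X1 w, X2 w) = \int[e]_s \int[e]_t \int[e]_r f (s, t, r).
Proof.
move=> XE f mf f0.
have mX01 : measurable_fun setT (fun w => (X0 w, X1 w)) by exact/measurable_fun_pair.
have mX : measurable_fun setT (fun w => (X0 w, X1 w, X2 w)) by exact/measurable_fun_pair.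
pose law := measure_function_pushforward__canonical__measure_function_Measure Pr mX.
have lawE A C : measurable A -> measurable C -> law (A `*` C) = (e \x e) A * e C.
  move=> mA mC; have mX2C : measurable (X2 @^-1` C).
    by rewrite -[X in measurable X]setTI; apply: measurable_funP.
  pose law01 := measure_function_pushforward__canonical__measure_function_Measure
    (mrestr Pr mX2C) mX01.
  have eC0 : (0 <= fine (e C))%R by rewrite fine_ge0.
  have eCE : (fine (e C))%:E = e C by rewrite fineK// fin_num_measure.
  have := @product_measure_unique _ _ _ _ R e (mscale (NngNum eC0) e) law01.
  move=> /(_ _ _ mA) H; rewrite muleC -eCE -(product_mscale e e (NngNum eC0) mA) H.
    by rewrite /law /law01 /= /pushforward /mrestr; congr (Pr _); apply/seteqP; split => w [].
  move=> A0 A1 mA0 mA1; rewrite /law01 /= /pushforward /mrestr /mscale/= eCE.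
  transitivity (Pr (X0 @^-1` A0 `&` X1 @^-1` A1 `&` X2 @^-1` C)).
    by congr (Pr _); apply/seteqP; split => w [].
  by rewrite XE// -muleA [e A1 * _]muleC.
pose ee : probability (R * R)%type R := e \x e.
have lawP : forall Z, measurable Z -> (ee \x e) Z = law Z.
  by apply: (@product_measure_unique _ _ _ _ R ee e law) => A B mA mB; exact: lawE.
transitivity (\int[law]_z f z).
  by rewrite /law /= ge0_integral_pushforward.
transitivity (\int[ee \x e]_z f z).
  by apply: eq_measure_integral => Z mZ _; exact/esym/lawP.
rewrite (@fubini_tonelli1 _ _ _ _ R ee e f mf f0).
rewrite (@fubini_tonelli1 _ _ _ _ R e e (fun p => \int[e]_r f (p, r)))//.
  exact: (@measurable_fun_fubini_tonelli_F _ _ _ _ R e f mf f0).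
by move=> p; exact: integral_ge0.
Qed.

End JointLaw.

Section BoxIntegral.
Context {R : realType}.
Notation S := (R * R * R)%type.

Lemma box_integral_cst (l u : S) (c : R) :
  l.1.1 < u.1.1 -> l.1.2 < u.1.2 -> l.2 < u.2 -> 0 <= c ->
  box_integral l u (fun=> c%:E) =
  (c * ((u.1.1 - l.1.1) * ((u.2 - l.2) * (u.1.2 - l.1.2))))%:E.
Proof.
move=> l1 l2 l3 c0; rewrite /box_integral.
have cst_itv (a b k : R) : a < b ->
    (\int[lebR]_(_ in `[a, b]) k%:E = (k * (b - a))%:E)%E.
  move=> ab; rewrite (integral_cst lebR); last exact: measurable_itv.
  rewrite EFinM; congr (_ * _)%E; apply: etrans (lebR_itv `[a, b]) _.
  by rewrite /= lte_fin ab -EFinB.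
under eq_integral do under eq_integral do rewrite cst_itv//.
under eq_integral do rewrite cst_itv//.
by rewrite cst_itv// -!mulrA.
Qed.

Lemma box_integralD (l u : S) (G H : S -> \bar R) :
  measurable_fun setT G -> measurable_fun setT H ->
  (forall y, 0 <= G y)%E -> (forall y, 0 <= H y)%E ->
  (box_integral l u (fun y => G y + H y) = box_integral l u G + box_integral l u H)%E.
Proof.
move=> mG mH G0 H0.
have mS : measurable_fun setT (fun p : (R * R) * R => (p.2, p.1.1, p.1.2)) by meas.
have inner (K : S -> \bar R) : measurable_fun setT K -> (forall y, 0 <= K y)%E ->
    measurable_fun setT (fun p : R * R => \int[lebR]_(a in `[l.1.1, u.1.1]) K (a, p.1, p.2))%E.
  move=> mK K0; apply: (@measurable_integral_param _ _ _ _ R lebR _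
    (fun (p : R * R) a => K (a, p.1, p.2))) => //.
  exact: (measurableT_comp mK mS).
have middle (K : S -> \bar R) : measurable_fun setT K -> (forall y, 0 <= K y)%E ->
    measurable_fun setT (fun B : R => \int[lebR]_(C in `[l.2, u.2])
      \int[lebR]_(a in `[l.1.1, u.1.1]) K (a, B, C))%E.
  move=> mK K0; apply: (@measurable_integral_param _ _ _ _ R lebR _
    (fun B C => \int[lebR]_(a in `[l.1.1, u.1.1]) K (a, B, C))%E) => //.
  - exact: inner.
  - by move=> B C; exact: integral_ge0.
have mitv (a b : R) : measurable `[a, b] by exact: measurable_itv.
rewrite /box_integral -ge0_integralD//; first last.
- by apply: measurable_funTS; exact: middle.
- by move=> B _; do 2 (apply: integral_ge0 => ? _).
- by apply: measurable_funTS; exact: middle.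
- by move=> B _; do 2 (apply: integral_ge0 => ? _).
apply: eq_integral => B _; rewrite -ge0_integralD//; first last.
- by apply: measurable_funTS; exact: (measurableT_comp (inner _ mH H0) (pair1_measurable B)).
- by move=> C _; apply: integral_ge0.
- by apply: measurable_funTS; exact: (measurableT_comp (inner _ mG G0) (pair1_measurable B)).
- by move=> C _; apply: integral_ge0.
apply: eq_integral => C _; rewrite -ge0_integralD//.
- apply: measurable_funTS; apply: (measurableT_comp mG (g := fun a => (a, B, C))).
  by apply/measurable_fun_pair => //; apply/measurable_fun_pair.
- apply: measurable_funTS; apply: (measurableT_comp mH (g := fun a => (a, B, C))).
  by apply/measurable_fun_pair => //; apply/measurable_fun_pair.
Qed.

End BoxIntegral.

(** * The transition operator of the chain and its minorization *)

Section Assembly.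
Context {R : realType} {d : measure_display} {Omega : measurableType d}.
Variable Pr : probability Omega R.
Notation S := (R * R * R)%type.

Lemma independent_triple (X : nat -> {RV Pr >-> R}) (A B C : set R) :
  mutually_independent X -> measurable A -> measurable B -> measurable C ->
  (Pr (X 0%N @^-1` A `&` X 1%N @^-1` B `&` X 2%N @^-1` C) =
   Pr (X 0%N @^-1` A) * Pr (X 1%N @^-1` B) * Pr (X 2%N @^-1` C))%E.
Proof.
move=> indep mA mB mC.
pose E i := if i == 0%N then A else if i == 1%N then B else C.
have mE i : measurable (E i) by rewrite /E; case: ifP => // _; case: ifP.
have := indep (0%N |` (1%N |` [fset 2%N]))%fset E mE.
rewrite big_fsetU1/= ?inE// big_fsetU1/= ?inE// big_seq_fset1 /E/= muleA => <-.
congr (Pr _); apply/seteqP; split => w.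
  move=> [[h0 h1] h2] i /=; rewrite !inE => /orP[/eqP ->//|/orP[/eqP ->//|/eqP ->//]].
by move=> H; split; [split|]; [apply: (H 0%N)|apply: (H 1%N)|apply: (H 2%N)]; rewrite /= !inE.
Qed.

Variables (f1 f2 f3 : circle R -> R) (phi1 phi2 phi3 : R -> torus R -> torus R)
  (h : R) (tau : nat -> {RV Pr >-> R}).
Hypotheses (f1_analytic : circle_analytic f1) (f2_analytic : circle_analytic f2)
  (f3_analytic : circle_analytic f3).
Hypotheses (phi1_flow : is_flow (X1 f1) phi1) (phi2_flow : is_flow (X2 f2) phi2)
  (phi3_flow : is_flow (X3 f3) phi3).
Hypotheses (h_gt0 : 0 < h) (tau_iid : iid_exponential h tau).

Let F1 := circle_lift f1. Let D1 := derive1 F1.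
Let F2 := circle_lift f2. Let D2 := derive1 F2.
Let F3 := circle_lift f3. Let D3 := derive1 F3.
Let e : probability R R := distribution Pr (tau 0%N).
Let step w x := Phi phi1 phi2 phi3 (fun k => tau k w) 1 x.
Let P := transition_op Pr step.
Let Q G := flow_average e (flow1 F1 D1) (flow_average e (flow2 F2 D2)
    (flow_average e (flow3 F3 D3) G)).
Let lift (g : torus R -> R) (y : S) : \bar R := (g (torus_proj y))%:E.

Lemma analytic_regular (f : circle R -> R) : circle_analytic f ->
  [/\ forall x, derivable (circle_lift f) x 1, continuous (circle_lift f),
    continuous (derive1 (circle_lift f)),
    forall x, locally_lipschitz_at (circle_lift f) x &
    forall x, locally_lipschitz_at (derive1 (circle_lift f)) x].
Proof.
move=> /real_analytic_derive[dF /real_analytic_derive[dD /real_analytic_derive[dDD _]]].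
have dc (g : R -> R) : (forall x, derivable g x 1) -> continuous g.
  by move=> dg y; apply: differentiable_continuous; apply/derivable1_diffP.
split; [exact: dF|exact: dc|exact: dc| |].
  exact: derivable_locally_lipschitz dF (dc _ dD).
exact: derivable_locally_lipschitz dD (dc _ dDD).
Qed.

Let good1 : good_flow (flow1 F1 D1).
Proof.
have [dF cF cD _ _] := analytic_regular f1_analytic.
have pF := @circle_lift_periodic R f1; exact: good_flow1 cF cD pF (derive1_periodic pF).
Qed.

Let good2 : good_flow (flow2 F2 D2).
Proof.
have [dF cF cD _ _] := analytic_regular f2_analytic.
have pF := @circle_lift_periodic R f2; exact: good_flow2 cF cD pF (derive1_periodic pF).
Qed.

Let good3 : good_flow (flow3 F3 D3).
Proof.
have [dF cF cD _ _] := analytic_regular f3_analytic.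
have pF := @circle_lift_periodic R f3; exact: good_flow3 cF cD pF (derive1_periodic pF).
Qed.

Let stepE w y : step w (torus_proj y) =
  torus_proj (flow3 F3 D3 (tau 2%N w) (flow2 F2 D2 (tau 1%N w) (flow1 F1 D1 (tau 0%N w) y))).
Proof.
by rewrite -(flow3_unique phi3_flow) -(flow2_unique phi2_flow) -(flow1_unique phi1_flow).
Qed.

Let measurable_fl : measurable_fun setT (fun p : S * S => flow3 F3 D3 p.2.2
  (flow2 F2 D2 p.2.1.2 (flow1 F1 D1 p.2.1.1 p.1))).
Proof.
have [m1 _ _ _] := good1; have [m2 _ _ _] := good2; have [m3 _ _ _] := good3.
have mf1 : measurable_fun setT (fun p : S * S => flow1 F1 D1 p.2.1.1 p.1).
  by apply: (measurableT_comp m1 (g := fun p : S * S => (p.2.1.1, p.1))); meas.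
have mf2 : measurable_fun setT (fun p : S * S => flow2 F2 D2 p.2.1.2 (flow1 F1 D1 p.2.1.1 p.1)).
  apply: (measurableT_comp m2 (g := fun p : S * S => (p.2.1.2, flow1 F1 D1 p.2.1.1 p.1))).
  by apply/measurable_fun_pair => //; meas.
apply: (measurableT_comp m3 (g := fun p : S * S =>
  (p.2.2, flow2 F2 D2 p.2.1.2 (flow1 F1 D1 p.2.1.1 p.1)))).
by apply/measurable_fun_pair => //; meas.
Qed.

Let measurable_tau : measurable_fun setT (fun w => (tau 0%N w, tau 1%N w, tau 2%N w)).
Proof. by do 2 (apply/measurable_fun_pair => //). Qed.

Let measurable_step x : measurable_fun setT (step ^~ x : Omega -> borel_torus R).
Proof.
rewrite -(torus_sectionK x) (_ : step ^~ _ = (fun z => torus_proj (flow3 F3 D3 z.2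
  (flow2 F2 D2 z.1.2 (flow1 F1 D1 z.1.1 (torus_section x))))) \o
  (fun w => (tau 0%N w, tau 1%N w, tau 2%N w))).
  apply: measurableT_comp => //; apply: (measurableT_comp measurable_torus_proj).
  exact: (measurableT_comp measurable_fl (pair1_measurable (torus_section x))).
by apply/funext => w; rewrite stepE.
Qed.

Let bmeas_step (g : borel_torus R -> R) x : bmeas g -> bmeas (fun w => g (step w x)).
Proof.
move=> [mg [M gM]]; split; last by exists M.
exact: (measurableT_comp mg (measurable_step x)).
Qed.

Let PE (g : borel_torus R -> R) x : P g x = \int[Pr]_w g (step w x).
Proof. by rewrite /P /transition_op unlock. Qed.

Let tau_law i A : measurable A -> Pr (tau i @^-1` A) = e A.
Proof.
have [_ law] := tau_iid; move=> mA; have := law i A mA; have := law 0%N A mA.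
by rewrite /distribution /pushforward => <- ->.
Qed.

Let lift_admissible (g : borel_torus R -> R) : bmeas g -> (forall x, 0 <= g x) ->
  admissible (lift g).
Proof.
move=> [mg _] g0; split.
- by apply/measurable_EFinP; exact: (measurableT_comp mg measurable_torus_proj).
- by move=> y; rewrite lee_fin.
- by move=> k y; rewrite /lift torus_proj_translate.
Qed.

(** The bridge between the probabilistic operator and the iterated integrals over explicit flows.
    Nonnegativity allows [Q] to be handled with Tonelli in the extended reals; independence enters
    through [joint_law3]. *)
Let PQ (g : borel_torus R -> R) y : bmeas g -> (forall x, 0 <= g x) ->
  (P g (torus_proj y))%:E = Q (lift g) y.
Proof.
move=> bg g0; rewrite PE /Rintegral fineK; last first.
  by apply: integrable_fin_num => //; apply: (@bmeas_integrable _ _ _ Pr); exact: bmeas_step.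
have [mG G0 _] := lift_admissible bg g0.
transitivity (\int[Pr]_w (fun z : S => lift g (flow3 F3 D3 z.2 (flow2 F2 D2 z.1.2
    (flow1 F1 D1 z.1.1 y)))) (tau 0%N w, tau 1%N w, tau 2%N w))%E.
  by apply: eq_integral => w _; rewrite /lift -stepE.
apply: (@joint_law3 _ _ _ Pr (tau 0%N) (tau 1%N) (tau 2%N) e _ (fun z : S =>
  lift g (flow3 F3 D3 z.2 (flow2 F2 D2 z.1.2 (flow1 F1 D1 z.1.1 y))))) => //.
- move=> A B C mA mB mC; have [indep _] := tau_iid.
  by rewrite independent_triple// !tau_law.
- apply: (measurableT_comp mG).
  exact: (measurableT_comp measurable_fl (pair1_measurable y)).
Qed.

Let Q_admissible G : admissible G -> admissible (Q G).
Proof.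
move=> aG; apply: (flow_average_admissible _ good1).
exact: (flow_average_admissible _ good2 (flow_average_admissible _ good3 aG)).
Qed.

Lemma transition_markov : markov_operator P.
Proof.
have Pbpc x : bpc_functional (P ^~ x).
  split=> [a g1 g2 b1 b2|u g M bu bg uM ug].
    by rewrite !PE (bpc_lin (Rintegral_bpc Pr)) //; exact: bmeas_step.
  under eq_fun do rewrite PE.
  rewrite PE; apply: (bpc_cvg (Rintegral_bpc Pr) (M := M)) => //.
  - by move=> n; exact: bmeas_step.
  - exact: bmeas_step.
have P1 (a : R) x : P (fun=> a) x = a.
  rewrite PE (@Rintegral_cst _ _ _ Pr _ measurableT).
  by have /= -> := @probability_setT _ _ _ Pr; rewrite mulr1.
have Pge0 g : bmeas g -> (forall x, 0 <= g x) -> forall x, 0 <= P g x.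
  by move=> bg g0 x; rewrite PE; apply: Rintegral_ge0.
split => // g bg; have [_ [M gM]] := bg.
(* The identity [PQ] concerns nonnegative functions, so measurability of [P g] is proved for [g + M]
   and the constant is subtracted afterwards. *)
have gM0 x : 0 <= 1 * g x + M.
  by rewrite mul1r -lerBlDr sub0r; have := gM x; rewrite ler_norml => /andP[].
have bgM : bmeas (fun x => 1 * g x + M) by apply: bmeas_lin => //; exact: bmeas_cst.
have PgE x : P g x = 1 * P (fun x => 1 * g x + M) x + (- M).
  by rewrite (bpc_lin (Pbpc x) 1 bg (bmeas_cst M)) P1; ring.
have mP : measurable_fun setT (P (fun x => 1 * g x + M)).
  apply: measurable_torus_lift; apply/measurable_EFinP.
  rewrite (_ : EFin \o _ = Q (lift (fun x => 1 * g x + M))); last first.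
    by apply/funext => y; rewrite /= PQ.
  by have [] := Q_admissible (lift_admissible bgM gM0).
split.
  rewrite (_ : P g = fun x => 1 * P (fun x => 1 * g x + M) x + (- M)); last exact/funext.
  by apply: measurable_funD => //; apply: measurable_funM => //.
exists M => x; rewrite ler_norml -{1}(P1 (- M) x) -{2}(P1 M x) !PE.
by apply/andP; split; apply: le_Rintegral => //; try (apply: bmeas_integrable);
  try exact: bmeas_cst; try exact: bmeas_step;
  move=> w _; have := gM (step w x); rewrite ler_norml => /andP[].
Qed.

Lemma iter_transition n (g : borel_torus R -> R) y : bmeas g -> (forall x, 0 <= g x) ->
  (iter n P g (torus_proj y))%:E = iter n Q (lift g) y.
Proof.
move=> bg g0; elim: n y => [//|n IH] y.
have mn := markov_iter n transition_markov.
rewrite [LHS]PQ; [|exact: (mo_bmeas mn)|exact: (mo_ge0 mn)].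
by rewrite iterS; congr (Q _ y); apply/funext => z; rewrite /lift IH.
Qed.

Lemma iter_Q_admissible n G : admissible G -> admissible (iter n Q G).
Proof.
by move=> aG; elim: n => [|n IH]; [exact: aG|rewrite iterS; exact: (Q_admissible IH)].
Qed.

Hypotheses (f1_nonconstant : nonconstant f1) (f2_nonconstant : nonconstant f2)
  (f3_nonconstant : nonconstant f3).
Hypotheses (f1_H1 : H1 f1) (f2_H1 : H1 f2) (f3_H1 : H1 f3).

Lemma H1_nondegenerate (f : circle R -> R) : H1 f ->
  forall x, derive1 (circle_lift f) x = 0 -> circle_lift f x != 0.
Proof.
move=> [fD _] x Dx; apply/eqP => Fx.
suff : (zero_set f `&` zero_set (circle_deriv f)) (circle_proj x) by rewrite fD.
by split; [exact: Fx|rewrite /zero_set/= circle_derivE].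
Qed.

Lemma lift_derive1_nonroot (f : circle R -> R) : circle_analytic f -> nonconstant f ->
  exists x, derive1 (circle_lift f) x != 0.
Proof.
move=> fan [x [y fxy]]; have [dF _ _ _ _] := analytic_regular fan.
apply: derive1_nonroot => //; exists (repr x), (repr y).
have reprE z : circle_proj (repr z) = z by exact: reprK.
by rewrite /circle_lift/= !reprE.
Qed.

Lemma lift_derive1_root (f : circle R -> R) : circle_analytic f ->
  exists x, derive1 (circle_lift f) x = 0.
Proof.
move=> fan; have [dF _ _ _ _] := analytic_regular fan.
by apply: derive1_root dF; exact: circle_lift_periodic.
Qed.

Lemma tau_dominates : dominates_lebesgue e.
Proof.
apply: (@exponential_dominates_lebesgue _ e h^-1); first by rewrite invr_gt0.
by move=> A mA; have [_ law] := tau_iid; exact: law.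
Qed.

Lemma transition_minorized : exists l u : S, [/\ l.1.1 < u.1.1, l.1.2 < u.1.2 & l.2 < u.2] /\
  exists2 eps : R, 0 < eps & forall y G, admissible G ->
    (eps%:E * box_integral l u G <= iter 4 Q G y)%E.
Proof.
have [_ cF1 cD1 _ _] := analytic_regular f1_analytic.
have [_ cF2 cD2 lF2 lD2] := analytic_regular f2_analytic.
have [_ cF3 cD3 _ _] := analytic_regular f3_analytic.
have p1 := @circle_lift_periodic R f1; have p2 := @circle_lift_periodic R f2.
have p3 := @circle_lift_periodic R f3.
have [l [u [lu Hlu]]] := minorized_everywhere tau_dominates cF1 cD1 cF2 cD2 cF3 cD3
  p1 (derive1_periodic p1) p2 (derive1_periodic p2) p3 (derive1_periodic p3) lF2 lD2
  (H1_nondegenerate f1_H1) (H1_nondegenerate f2_H1) (H1_nondegenerate f3_H1)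
  (lift_derive1_root f1_analytic) (lift_derive1_nonroot f1_analytic f1_nonconstant)
  (lift_derive1_root f2_analytic) (lift_derive1_nonroot f2_analytic f2_nonconstant)
  (lift_derive1_root f3_analytic) (lift_derive1_nonroot f3_analytic f3_nonconstant).
exists l, u; split; first exact: lu.
exact: (minorized_uniform (@iter_Q_admissible 4) Hlu).
Qed.

Lemma transition_doeblin : exists2 a : R, 0 < a < 1 &
  forall (c : R) (u v : borel_torus R -> R), 0 <= c -> bmeas u -> bmeas v ->
  (forall y, 0 <= u y) -> (forall y, 0 <= v y) -> (forall y, u y + v y = c) ->
  forall x y, a * c <= iter 4 P u x + iter 4 P v y.
Proof.
have [l [u [[l1 l2 l3] [eps eps0 minor]]]] := transition_minorized.
pose vol := (u.1.1 - l.1.1) * ((u.2 - l.2) * (u.1.2 - l.1.2)).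
have vol0 : 0 < vol by rewrite !mulr_gt0 ?subr_gt0.
(* The minimum with [1 / 2] keeps the constant below 1, as required for a positive rate. *)
exists (Num.min (eps * vol) (1 / 2)).
  by rewrite lt_min mulr_gt0//= divr_gt0//= gt_min [1 / 2 < 1]ltr_pdivrMr// mul1r ltr1n orbT.
move=> c g1 g2 c0 b1 b2 g10 g20 g12 x y.
apply: (@le_trans _ _ (eps * vol * c)); first by rewrite ler_wpM2r// ge_min lexx.
rewrite -(torus_sectionK x) -(torus_sectionK y) -lee_fin EFinD !iter_transition//.
have a1 := lift_admissible b1 g10; have a2 := lift_admissible b2 g20.
apply: le_trans (leeD (minor (torus_section x) _ a1) (minor (torus_section y) _ a2)).
have [m1 p1 _] := a1; have [m2 p2 _] := a2.
(* The same box integral bounds the iterates at both points, so the two bounds add up to that of the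
   constant function [c]. *)
rewrite -ge0_muleDr ?box_integral_ge0// -box_integralD//.
rewrite (_ : (fun z => (lift g1 z + lift g2 z)%E) = fun=> c%:E); last first.
  by apply/funext => z; rewrite /lift -EFinD g12.
by rewrite box_integral_cst// -EFinM lee_fin -/vol -mulrA (mulrC c).
Qed.

Let transition_kernelE x (D : set (borel_torus R)) : measurable D ->
  transition_kernel Pr step x D = (P \1_D x)%:E.
Proof.
move=> mD; rewrite PE /Rintegral fineK; last first.
  apply: integrable_fin_num => //; apply: (@bmeas_integrable _ _ _ Pr).
  by apply: bmeas_step; exact: bmeas_indic.
rewrite (_ : (fun w => (\1_D (step w x))%:E) = EFin \o \1_[set w | D (step w x)]).
  rewrite integral_indic ?setIT//.
  by rewrite -[X in measurable X]setTI; exact: (measurable_step x).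
by apply/funext => w.
Qed.

Lemma transition_ergodic : exists mu : probability (borel_torus R) R,
  [/\ stationary Pr step mu,
      (forall nu : probability (borel_torus R) R, stationary Pr step nu ->
        forall D : set (borel_torus R), measurable D -> nu D = mu D) &
      exists C gamma : R, [/\ 0 < C, 0 < gamma < 1 &
        forall (m : nat) (x : borel_torus R) (g : borel_torus R -> R),
          measurable_fun setT g -> (exists M : R, forall y, `|g y| <= M) ->
          `|iter m P g x - \int[mu]_y g y| <= C * sup_norm g * gamma ^+ m]].
Proof.
have [a /andP[a0 a1] doeb] := transition_doeblin.
have [mu [mu_inv mu_uniq [C [gamma [C0 gamma01 rate]]]]] :=
  doeblin_ergodic transition_markov (isT : (0 < 4)%N) a0 a1 doeb
    (torus_proj (0, 0, 0) : borel_torus R).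
have dualE (nu : probability (borel_torus R) R) D : measurable D ->
    transition_dual Pr step nu D = (\int[nu]_x P \1_D x)%:E.
  move=> mD; rewrite /transition_dual /Rintegral fineK; last first.
    apply: integrable_fin_num => //; apply: (@bmeas_integrable _ _ _ nu).
    by apply: (mo_bmeas transition_markov); exact: bmeas_indic.
  by apply: eq_integral => x _; rewrite transition_kernelE.
exists mu; split.
- move=> D mD; rewrite dualE// mu_inv; last exact: bmeas_indic.
  rewrite /Rintegral fineK; last first.
    by apply: integrable_fin_num => //; apply: (@bmeas_integrable _ _ _ mu); exact: bmeas_indic.
  by rewrite integral_indic// setIT.
- move=> nu nu_st; apply: mu_uniq => D mD.
  by rewrite -nu_st// dualE.
exists C, gamma; split => // m x g mg [M gM]; apply: rate; first by split; [|exists M].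
move=> y; apply: ub_le_sup; last by exists y.
by exists M => _ [z _ <-].
Qed.

End Assembly.

Theorem theorem2p2 (R : realType)
  (f1 f2 f3 : circle R -> R)
  (f1_analytic : circle_analytic f1)
  (f2_analytic : circle_analytic f2)
  (f3_analytic : circle_analytic f3)
  (f1_nonconstant : nonconstant f1)
  (f2_nonconstant : nonconstant f2)
  (f3_nonconstant : nonconstant f3)
  (f1_H1 : H1 f1) (f2_H1 : H1 f2) (f3_H1 : H1 f3)
  (phi1 phi2 phi3 : R -> torus R -> torus R)
  (phi1_flow : is_flow (X1 f1) phi1)
  (phi2_flow : is_flow (X2 f2) phi2)
  (phi3_flow : is_flow (X3 f3) phi3)
  (h : R) (h_gt0 : 0 < h)
  (d : measure_display) (Omega : measurableType d) (Pr : probability Omega R)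
  (tau : nat -> {RV Pr >-> R})
  (tau_iid : iid_exponential h tau) :
  let Phi_tau : Omega -> torus R -> torus R :=
    fun w => Phi phi1 phi2 phi3 (fun k => tau k w) 1 in
  exists mu : probability (borel_torus R) R,
    [/\ stationary Pr Phi_tau mu,
        (forall nu : probability (borel_torus R) R,
           stationary Pr Phi_tau nu ->
           forall D : set (borel_torus R), measurable D -> nu D = mu D) &
        exists C gamma : R,
          [/\ 0 < C, 0 < gamma < 1 &
              forall (m : nat) (x : borel_torus R) (g : borel_torus R -> R),
                measurable_fun setT g ->
                (exists M : R, forall y, `|g y| <= M) ->
                `|iter m (transition_op Pr Phi_tau) g x - \int[mu]_y g y|
                  <= C * sup_norm g * gamma ^+ m]].
Proof.
exact: (transition_ergodic f1_analytic f2_analytic f3_analytic phi1_flow phi2_flow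
  phi3_flow h_gt0 tau_iid f1_nonconstant f2_nonconstant f3_nonconstant f1_H1 f2_H1 f3_H1).
Qed.
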